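(* Let $n\ge 1$ and let $\lambda,\mu$ be partitions of $n$. Let $ABC(\lambda,\mu)$ denote the set of affine Bruhat counter-tableaux (with $k=n$) of $n$-weight $\mu$ and inner shape $\mathfrak{c}(\lambda)$, and let $SSYT(\lambda,\mu)$ denote the set of semistandard tableaux of shape $\lambda$ and weight $\mu$. Then there is a bijection $ABC(\lambda,\mu)\to SSYT(\lambda,\mu)$ which is charge preserving, i.e. $ch(A)=ch(T)$ whenever $A\mapsto T$.
   Context: Partitions are drawn as Ferrers diagrams in French convention: $\lambda=(\lambda_1\ge\lambda_2\ge\cdots)$ has $\lambda_i$ left-justified cells in its $i$-th row counted from the bottom. The hook length of a cell is $1$ plus the number of cells to its right in its row plus the number of cells above it in its column. Fix an integer $k>0$ (in the claim, $k=n$). A $(k+1)$-core is a partition having no cell of hook length $k+1$; $\deg(\kappa)$ is the number of cells of $\kappa$ of hook length $\le k$. $\mathcal P^k$ is the set of partitions with $\lambda_1\le k$. For a $(k+1)$-core $\kappa$, the sequence whose $i$-th term is the number of cells in row $i$ of $\kappa$ with hook length $\le k$ is a partition in $\mathcal P^k$; this is a bijection from $(k+1)$-cores to $\mathcal P^k$, and $\mathfrak c:\mathcal P^k\to\{(k+1)\text{-cores}\}$ denotes its inverse. Strong order on cores: $\rho\lessdot_B\gamma$ iff $\rho\subseteq\gamma$ and $\deg(\gamma)=\deg(\rho)+1$. For a core $\lambda$, $(k+\lambda_1,\lambda)$ denotes the partition with first part $k+\lambda_1$ followed by the parts of $\lambda$. Bottom strong strip: for cores $\nu\subseteq(k+\lambda_1,\lambda)$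 and an integer $0\le m\le k-1$, the skew shape $(k+\lambda_1,\lambda)/\nu$ is a bottom strong strip of length $m$ if there is a saturated chain of cores $\nu=\nu^0\lessdot_B\nu^1\lessdot_B\cdots\lessdot_B\nu^m=(k+\lambda_1,\lambda)$ such that $(k+\lambda_1,\lambda)/\nu$ is a horizontal strip (no two cells in one column) and, for each $1\le j\le m$, the rightmost cell of the bottom (first) row of $\nu^j$ lies in $\nu^j/\nu^{j-1}$. Such a chain is unique. Affine Bruhat counter-tableau (ABC): let $\alpha=(\alpha_1,\dots,\alpha_\ell)$ with $1\le\alpha_i\le k$. An ABC $A$ of $k$-weight $\alpha$ is determined by $(k+1)$-cores $\emptyset=\lambda^{(0)},\lambda^{(1)},\dots,\lambda^{(\ell)}$ such that for each $i$, $(k+\lambda^{(i-1)}_1,\lambda^{(i-1)})/\lambda^{(i)}$ is a bottom strong strip of length $k-\alpha_i$. $A$ is a diagram with $\ell$ left-justified rows numbered $1,\dots,\ell$ from top to bottom (columns numbered $1,2,\dots$ from the left), where for each $i$ rows $1,\dots,i$, viewed with row $i$ as the bottom row, form the Ferrers diagram of $(k+\lambda^{(i-1)}_1,\lambda^{(i-1)})$; the cells of $(k+\lambda^{(i-1)}_1,\lambda^{(i-1)})/\lambda^{(i)}$ are filled with the letter $i$, and the cells of $\lambda^{(\ell)}$ are empty. The inner shape of $A$ is $\lambda^{(\ell)}$. The cells filled with $i$ are partitioned into ribbons (here runs of consecutive cells in one row), namely the connected components of the $\nu^j/\nu^{j-1}$ from the chain for the $i$-th strip; these are called $i$-ribbons.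 The head of a ribbon is its rightmost cell and its tail its leftmost cell. $A$ has partition $k$-weight $\mu$ if $\alpha=\mu$ is a partition. Extension: for an ABC $A$ of partition $k$-weight $\mu$, let $s_i$ be the total size and $r_i$ the number of $i$-ribbons in row $i$ of $A$. $ext(A)$ is obtained by appending $k$ cells containing $i$ at the right end of each row $i$, where the first $\mu_i-s_i+r_i+1$ appended cells form one $i$-ribbon and each remaining appended cell is an $i$-ribbon of size one. Let $V_A$ be the set of cells $(i,c)$ (row $i$, column $c$) of $ext(A)$ lying in an $i$-ribbon of row $i$ and not equal to that ribbon's tail. Sets $E_A^r$, $r=1,\dots,\mu_1$, constructed successively: $E_A^r$ contains the cell $(1,k+\mu_1+2-r)$; for $i\ge2$, $(i,c_i)\in E_A^r$ iff $E_A^r$ contains a cell $(i-1,c_{i-1})$ and $(i,c_i)\in V_A\setminus\bigcup_{p<r}E_A^p$ with $(c_{i-1}-c_i+k)\bmod (k+1)=\min\{(c_{i-1}-x+k)\bmod(k+1): (i,x)\in V_A\setminus\bigcup_{p<r}E_A^p\}$. Reading words: given cells $(1,c_1),\dots,(m,c_m)$ (one per row $1,\dots,m$), build a permutation of $\{1,\dots,m\}$ starting from the word $1$ and, for $i=2,\dots,m$, inserting $i$ immediately to the right of the letter $j$, where $j<i$ is chosen among indices with $c_j<c_i$ so that $c_j$ is maximal (ties broken by the largest $j$); if no $j<i$ has $c_j<c_i$, insert $i$ at the beginning. $w_r(A)$ is the permutation so obtained from $E_A^r$. Charge: for a permutation $w$ of $\{1,\dots,n\}$, $ch(w)=\sum_{i=1}^n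 c_i$ with $c_1=0$ and $c_i=c_{i-1}+1$ if $i$ appears to the right of $i-1$ in $w$, $c_i=c_{i-1}$ otherwise. For a word $w$ whose content is a partition: the first charge subword is found by scanning from the right end of $w$ leftward, marking the first $1$, then continuing leftward (cyclically wrapping from the beginning to the end) marking the first $2$, and so on up to the largest letter; the marked letters in their order in $w$ form a permutation; remove them and repeat to get the subsequent charge subwords. $ch(w)$ is the sum of the charges of its charge subwords. A semistandard tableau is a filling of a Ferrers shape with positive integers weakly increasing along rows (left to right) and strictly increasing up columns; its weight has $i$-th entry the number of $i$'s; its reading word is the concatenation of its rows from the top row to the bottom row, each read left to right, and $ch(T)$ is the charge of its reading word. For an ABC $A$ of partition $k$-weight $\mu$, $ch(A)=\sum_{r=1}^{\mu_1}ch(w_r(A))$. *)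

(* Defs.v *)
From mathcomp Require Import all_boot all_order all_algebra.
From Stdlib Require Import ClassicalEpsilon.

Set Implicit Arguments.
Unset Strict Implicit.
Unset Printing Implicit Defensive.

(* A partition is a seq nat (l_1 >= l_2 >= ... > 0); row i (0-based) is the
   i-th row counted from the bottom.  A cell is (i, j), 0-based row and
   column; (i, j) is a cell of l iff j < l_i. *)

Definition is_partition (l : seq nat) : bool :=
  sorted geq l && all (fun x => 0 < x) l.

Definition partition_of (n : nat) (l : seq nat) : bool :=
  is_partition l && (sumn l == n).

Definition part (l : seq nat) (i : nat) : nat := nth 0 l i.

Definition cells (l : seq nat) : seq (nat * nat) :=
  [seq (i, j) | i <- iota 0 (size l), j <- iota 0 (part l i)].

Definition conj_part (l : seq nat) (j : nat) : nat := count (fun x => j < x) l.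

Definition hook (l : seq nat) (i j : nat) : nat :=
  1 + (part l i - j.+1) + (conj_part l j - i.+1).

Definition is_core (k : nat) (l : seq nat) : bool :=
  is_partition l && all (fun c => hook l c.1 c.2 != k.+1) (cells l).

Definition deg (k : nat) (l : seq nat) : nat :=
  count (fun c => hook l c.1 c.2 <= k) (cells l).

(* the map (k+1)-cores -> P^k : row i |-> number of cells of hook <= k
   (trailing zero rows discarded); c(lambda) is the core sent to lambda *)
Definition kshape (k : nat) (l : seq nat) : seq nat :=
  filter (fun x => 0 < x)
    [seq count (fun j => hook l i j <= k) (iota 0 (part l i)) | i <- iota 0 (size l)].

Definition subdiag (r g : seq nat) : bool :=
  all (fun i => part r i <= part g i) (iota 0 (size r)).

Definition strong_cover (k : nat) (r g : seq nat) : bool :=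
  [&& is_core k r, is_core k g, subdiag r g & deg k g == (deg k r).+1].

Definition bump (k : nat) (l : seq nat) : seq nat := (k + part l 0) :: l.

Definition hstrip (g nu : seq nat) : bool :=
  subdiag nu g &&
  all (fun j => count (fun i => (part nu i <= j) && (j < part g i))
                      (iota 0 (size g)) <= 1)
      (iota 0 (part g 0)).

(* ch = [nu^0; ...; nu^m] witnesses that g/nu is a bottom strong strip of
   length m.  The rightmost cell (0, nu^j_1 - 1) of the bottom row of nu^j
   lies in nu^j/nu^(j-1) iff nu^(j-1)_1 < nu^j_1 (given containment). *)
Definition bstrip_chain (k : nat) (nu g : seq nat) (m : nat)
    (ch : seq (seq nat)) : Prop :=
  [/\ size ch = m.+1, nth [::] ch 0 = nu, nth [::] ch m = g,
      hstrip g nu &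
      forall j, 0 < j <= m ->
        strong_cover k (nth [::] ch j.-1) (nth [::] ch j) /\
        part (nth [::] ch j.-1) 0 < part (nth [::] ch j) 0].

Definition bottom_strong_strip (k : nat) (nu g : seq nat) (m : nat) : Prop :=
  [/\ is_core k nu, is_core k g, m <= k.-1 &
      exists ch, bstrip_chain k nu g m ch].

(* the (unique, by the paper) chain of a bottom strong strip *)
Definition the_chain (k : nat) (nu g : seq nat) (m : nat) : seq (seq nat) :=
  epsilon (inhabits [::]) (bstrip_chain k nu g m).

(* An ABC of k-weight alpha is given by its cores
   lam = [lambda^(0); ...; lambda^(l)], l = size alpha. *)
Definition is_ABC (k : nat) (alpha : seq nat) (lam : seq (seq nat)) : Prop :=
  [/\ all (fun a => 0 < a <= k) alpha,
      size lam = (size alpha).+1,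
      nth [::] lam 0 = [::],
      (forall i, i < size lam -> is_core k (nth [::] lam i)) &
      (forall i, 0 < i <= size alpha ->
         bottom_strong_strip k (nth [::] lam i) (bump k (nth [::] lam i.-1))
                             (k - nth 0 alpha i.-1))].

Definition inner_shape (lam : seq (seq nat)) : seq nat := last [::] lam.

Section ABCCharge.
Variables (k : nat) (mu : seq nat) (lam : seq (seq nat)).

(* rows of A are numbered 1..size mu from top to bottom; row i of A is the
   bottom row of (k + lambda^(i-1)_1, lambda^(i-1)); columns are 1-based. *)
Definition row_gamma (i : nat) : seq nat := bump k (nth [::] lam i.-1).
Definition row_nu (i : nat) : seq nat := nth [::] lam i.
Definition row_m (i : nat) : nat := k - nth 0 mu i.-1.
Definition row_chain (i : nat) : seq (seq nat) :=
  the_chain k (row_nu i) (row_gamma i) (row_m i).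
Definition brk (i j : nat) : nat := part (nth [::] (row_chain i) j) 0.

(* the i-ribbon of row i coming from nu^j / nu^(j-1) occupies (1-based)
   columns brk (j-1) + 1 .. brk j *)
Definition ribbon_sizes (i : nat) : seq nat :=
  [seq brk i j - brk i j.-1 | j <- iota 1 (row_m i)].
Definition s_row (i : nat) : nat := sumn (ribbon_sizes i).
Definition r_row (i : nat) : nat := count (fun x => 0 < x) (ribbon_sizes i).
Definition len_row (i : nat) : nat := part (row_gamma i) 0.
(* size of the first appended ribbon of ext(A) *)
Definition ext_len (i : nat) : nat :=
  minn (nth 0 mu i.-1 + r_row i + 1 - s_row i) k.

(* columns c with (i,c) in V_A : non-tail cells of i-ribbons of row i *)
Definition Vrow (i : nat) : seq nat :=
  flatten [seq iota (brk i j.-1).+2 (brk i j - brk i j.-1).-1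
          | j <- iota 1 (row_m i)]
  ++ iota (len_row i).+2 (ext_len i).-1.

Definition modv (c x : nat) : nat :=
  absz (((c%:Z - x%:Z + k%:Z)%R %% (k.+1)%:Z)%Z).

Definition minl (s : seq nat) : nat := foldr minn (head 0 s) s.

(* given the columns of E^1..E^(mu_1) in row i-1, compute them in row i;
   used = columns of row i already taken by E^p, p < r *)
Fixpoint build_row (V : seq nat) (prev : seq (seq nat)) (used : seq nat)
  : seq (seq nat) :=
  match prev with
  | [::] => [::]
  | pr :: rest =>
      let avail := [seq x <- V | x \notin used] in
      let e := [seq x <- avail |
                 has (fun c => modv c x == minl [seq modv c y | y <- avail]) pr] in
      e :: build_row V rest (used ++ e)
  end.

Definition mu1 : nat := nth 0 mu 0.

(* Erow i = [E^1 row i; ...; E^(mu_1) row i] (columns) *)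
Fixpoint Erow (i : nat) : seq (seq nat) :=
  match i with
  | 0 => [::]
  | i'.+1 =>
      if i' is 0 then [seq [:: k + mu1 + 2 - r] | r <- iota 1 mu1]
      else build_row (Vrow i'.+1) (Erow i') [::]
  end.

Definition Ecols (r : nat) : seq nat :=
  let rows := iota 1 (size mu) in
  let m := find (fun i => nth [::] (Erow i) r.-1 == [::]) rows in
  [seq head 0 (nth [::] (Erow i) r.-1) | i <- take m rows].

End ABCCharge.

Definition insert_after (w : seq nat) (j i : nat) : seq nat :=
  let p := index j w in take p.+1 w ++ i :: drop p.+1 w.

Definition reading_perm (cs : seq nat) : seq nat :=
  if cs is [::] then [::] else
  foldl (fun w i =>
           let ci := nth 0 cs i.-1 in
           let cands := [seq j <- iota 1 i.-1 | nth 0 cs j.-1 < ci] in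
           if cands is [::] then i :: w else
           let bestc := foldr maxn 0 [seq nth 0 cs j.-1 | j <- cands] in
           let jb := last 0 [seq j <- cands | nth 0 cs j.-1 == bestc] in
           insert_after w jb i)
        [:: 1] (iota 2 (size cs).-1).

(* charge of a permutation w of {1..n}: c_1 = 0, c_i = c_(i-1) + [i right of i-1] *)
Definition perm_charge (w : seq nat) : nat :=
  sumn [seq sumn [seq nat_of_bool (index t.-1 w < index t w) | t <- iota 2 i.-1]
       | i <- iota 1 (size w)].

Definition ABC_charge (k : nat) (mu : seq nat) (lam : seq (seq nat)) : nat :=
  sumn [seq perm_charge (reading_perm (Ecols k mu lam r)) | r <- iota 1 (mu1 mu)].

(* positions scanned leftward cyclically, starting just left of position p *)
Definition cyc_order (n p : nat) : seq nat :=
  rev (take p (iota 0 n)) ++ rev (drop p (iota 0 n)).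

Fixpoint mark_from (w : seq nat) (letters : seq nat) (p : nat) : seq nat :=
  match letters with
  | [::] => [::]
  | a :: ls =>
      let q := nth 0 [seq x <- cyc_order (size w) p | nth 0 w x == a] 0 in
      q :: mark_from w ls q
  end.

Definition first_marks (w : seq nat) : seq nat :=
  mark_from w (iota 1 (foldr maxn 0 w)) (size w).

Fixpoint word_charge_fuel (fuel : nat) (w : seq nat) : nat :=
  match fuel with
  | 0 => 0
  | f.+1 =>
      if w is [::] then 0 else
      let P := first_marks w in
      let sub := [seq nth 0 w q | q <- iota 0 (size w) & q \in P] in
      let rest := [seq nth 0 w q | q <- iota 0 (size w) & q \notin P] in
      perm_charge sub + word_charge_fuel f rest
  end.

Definition word_charge (w : seq nat) : nat := word_charge_fuel (size w) w.

(* T = [row_1; row_2; ...], row_1 the bottom row *)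
Definition is_SSYT (lam mu : seq nat) (T : seq (seq nat)) : Prop :=
  [/\ size T = size lam,
      (forall i, i < size lam -> size (nth [::] T i) = part lam i),
      all (fun row => all (fun x => 0 < x) row && sorted leq row) T,
      (forall i j, j < size (nth [::] T i.+1) ->
         nth 0 (nth [::] T i) j < nth 0 (nth [::] T i.+1) j) &
      (forall a, count_mem a.+1 (flatten T) = nth 0 mu a)].

Definition tableau_word (T : seq (seq nat)) : seq nat := flatten (rev T).

Definition tableau_charge (T : seq (seq nat)) : nat := word_charge (tableau_word T).

(* ABC(lambda, mu) with k = n: n-weight mu, inner shape c(lambda), i.e. the
   (n+1)-core whose image under kshape n is lambda *)
Definition ABC_set (n : nat) (lam mu : seq nat) (A : seq (seq nat)) : Prop :=
  [/\ is_ABC n mu A, is_core n (inner_shape A) & kshape n (inner_shape A) = lam].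

(* Main.v *)
Require Import Defs.
From mathcomp Require Import all_boot all_order all_algebra.
From mathcomp Require Import zify.
From Stdlib Require Import ClassicalEpsilon.

Set Implicit Arguments.
Unset Strict Implicit.
Unset Printing Implicit Defensive.

(** A core of degree at most k = n has only small hooks, so every core of an
    ABC is an honest partition, and each bottom strong strip amounts to a
    horizontal strip between consecutive partitions; this is the usual
    encoding of a semistandard tableau T.  The chain of a strip is forced: a
    core (a, s) with s small satisfies a = d + s_(k-d) for a unique d, and a
    cover which lengthens the first row either raises d or adds a cell to the
    row k-d of s.  Reading off the ribbons, the column of a cell of V_A is
    k + 2 plus the content of the corresponding cell of T.  The sets E^r hence
    scan the letters of T cyclically by content, while charge subwords scan
    them by reading order.  The two orders differ only on cells lying in the
    row just above the scanned one and further to the right; these have been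
    used up by earlier subwords because each row is consumed from right to
    left, so both procedures select the same cells. *)

(* The unqualified name is taken by [fintype.bump]. *)
Local Notation bump := Defs.bump.

(** * Partitions *)

Lemma count_iota_interval p q N :
  q <= N -> count (fun i => p <= i < q) (iota 0 N) = q - p.
Proof.
move=> qN; rewrite -(subnKC qN) iotaD count_cat add0n.
rewrite [X in _ + X](@eq_in_count _ _ pred0) ?count_pred0 ?addn0; last first.
  by move=> i; rewrite mem_iota /= => /andP[qi _]; rewrite (ltnNge i) qi andbF.
rewrite (@eq_in_count _ _ (leq p)); last first.
  by move=> i; rewrite mem_iota => /= ->; rewrite andbT.
elim: q {N qN} => // q IHq; rewrite -addn1 iotaD count_cat IHq /= add0n addn0.
by case: (leqP p q); lia.
Qed.

Lemma part_cons0 a l : part (a :: l) 0 = a. Proof. by []. Qed.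

Lemma part_consS a l i : part (a :: l) i.+1 = part l i. Proof. by []. Qed.

Lemma part_nil i : part [::] i = 0. Proof. exact: nth_nil. Qed.

Lemma part_behead l i : part (behead l) i = part l i.+1.
Proof. by case: l => //; rewrite !part_nil. Qed.

Lemma is_partition_cons a l :
  is_partition (a :: l) = [&& 0 < a, part l 0 <= a & is_partition l].
Proof.
rewrite /is_partition /= /part; case: l => [|b l] /=; first by rewrite andbT.
by case: (0 < a); case: (b <= a) => //=; rewrite ?andbF.
Qed.

Lemma is_partition_behead l : is_partition l -> is_partition (behead l).
Proof. by case: l => // a l; rewrite is_partition_cons => /and3P[]. Qed.

Lemma is_partitionI l : (forall i, part l i.+1 <= part l i) ->
  (forall i, i < size l -> 0 < part l i) -> is_partition l.
Proof.
move=> l_dec l_pos; apply/andP; split; last exact/(all_nthP 0).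
by apply/(sortedP 0) => i _; apply: l_dec.
Qed.

Lemma sorted_leq_part l i j : sorted geq l -> i <= j -> part l j <= part l i.
Proof.
move=> sl ij; case: (ltnP j (size l)) => jl; last by rewrite /part nth_default.
have geq_trans : transitive geq by move=> y x z /= xy yz; apply: leq_trans xy.
by apply: (sorted_leq_nth geq_trans leqnn 0 sl) => //; apply: leq_ltn_trans jl.
Qed.

Lemma leq_part l i j : is_partition l -> i <= j -> part l j <= part l i.
Proof. by case/andP=> sl _; apply: sorted_leq_part. Qed.

Lemma leq_partS l i : is_partition l -> part l i.+1 <= part l i.
Proof. by move/leq_part; apply. Qed.

Lemma part_gt0 l i : is_partition l -> (0 < part l i) = (i < size l).
Proof.
case/andP=> _ /(all_nthP 0) l_pos; case: (ltnP i (size l)) => il.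
  exact: l_pos.
by rewrite /part nth_default.
Qed.

Lemma eq_from_part l l' :
  is_partition l -> is_partition l' -> part l =1 part l' -> l = l'.
Proof.
move=> Pl Pl' eq_ll'; have lt_size i : (i < size l) = (i < size l').
  by rewrite -!part_gt0 // eq_ll'.
apply: (@eq_from_nth _ 0) => [|i _]; last exact: eq_ll'.
by have := lt_size (size l); have := lt_size (size l'); lia.
Qed.

Lemma subdiagP r g : reflect (forall i, part r i <= part g i) (subdiag r g).
Proof.
apply: (iffP allP) => sub i; last by move=> _; apply: sub.
case: (ltnP i (size r)) => ir; first by apply: sub; rewrite mem_iota.
by rewrite /part nth_default.
Qed.

Lemma sumn_part l N : size l <= N -> sumn l = \sum_(0 <= i < N) part l i.
Proof.
move=> lN; rewrite sumnE (big_nth 0) [RHS](@big_cat_nat _ _ _ (size l)) //=.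
rewrite [X in _ = _ + X]big_nat_cond [X in _ = _ + X]big1 ?addn0 //.
move=> i /andP[/andP[li _] _].
by rewrite /part nth_default.
Qed.

Lemma sumn_add_cell l l' i :
  (forall s, part l' s = part l s + (s == i)) -> sumn l' = (sumn l).+1.
Proof.
move=> add_cell; pose N := size l + size l' + i.+1.
rewrite !(@sumn_part _ N); try by rewrite /N; lia.
rewrite (eq_bigr _ (fun s _ => add_cell s)) big_split -addn1; congr (_ + _).
transitivity (\sum_(0 <= s < N | s == i) 1); first by rewrite [RHS]big_mkcond.
by rewrite (big_nat1_eq _ (fun=> 1)) /= /N ltn_addl.
Qed.

Lemma sumn_subdiag_rows l l' s : subdiag l l' -> uniq s ->
  sumn l + \sum_(i <- s) (part l' i - part l i) <= sumn l'.
Proof.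
move=> /subdiagP sub us; pose N := size l + size l' + (\max_(i <- s) i).+1.
rewrite !(@sumn_part _ N); try by rewrite /N; lia.
rewrite -(eq_bigr _ (fun i _ => subnKC (sub i))) big_split leq_add2l.
apply: (uniq_sub_le_big leqnn (fun m n => leq_addr n m)) => //.
  exact: iota_uniq.
move=> i si; rewrite mem_index_iota ltn_addl // ltnS.
exact: (leq_bigmax_seq (F := id)).
Qed.

Lemma sumn_subdiag l l' : subdiag l l' -> sumn l <= sumn l'.
Proof.
move=> sub; have := @sumn_subdiag_rows _ _ [::] sub isT.
by rewrite big_nil addn0.
Qed.

Lemma sumn_subdiag_row l l' i :
  subdiag l l' -> sumn l + (part l' i - part l i) <= sumn l'.
Proof.
by move=> sub; have := @sumn_subdiag_rows _ _ [:: i] sub isT; rewrite big_seq1.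
Qed.

Lemma sumn_subdiag_row2 l l' i j : subdiag l l' -> i != j ->
  sumn l + (part l' i - part l i) + (part l' j - part l j) <= sumn l'.
Proof.
move=> sub ij; have := @sumn_subdiag_rows _ _ [:: i; j] sub.
by rewrite /= inE ij big_cons big_seq1 addnA => ->.
Qed.

Lemma subdiag_sumn_eq l l' : is_partition l -> is_partition l' ->
  subdiag l l' -> sumn l' <= sumn l -> l = l'.
Proof.
move=> Pl Pl' sub le_sumn; apply: eq_from_part => // i.
by have := sumn_subdiag_row i sub; have /subdiagP/(_ i) := sub; lia.
Qed.

Lemma size_leq_sumn l : is_partition l -> size l <= sumn l.
Proof.
elim: l => // a l IHl; rewrite is_partition_cons /= => /and3P[a0 _ /IHl].
lia.
Qed.

Lemma part_geq_sumn l i : is_partition l -> sumn l <= i -> part l i = 0.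
Proof.
move=> Pl li; rewrite /part nth_default //.
exact: leq_trans (size_leq_sumn Pl) li.
Qed.

Lemma part0D_leq_sumn l i :
  is_partition l -> 0 < part l i -> part l 0 + i <= sumn l.
Proof.
case: l => [|a l] Pl; first by rewrite part_nil.
rewrite part_gt0 //= ltnS leq_add2l => il.
by apply: leq_trans il (size_leq_sumn (is_partition_behead Pl)).
Qed.

Lemma ltn_conj_part l i j :
  is_partition l -> (i < conj_part l j) = (j < part l i).
Proof.
move=> Pl; case/andP: (Pl) => sl _; rewrite /conj_part.
elim: l sl Pl i => [|a l IHl] sl Pl i; first by rewrite part_nil.
have le_a i' : part l i' <= a := @leq_part _ 0 i'.+1 Pl (leq0n _).
have {}IHl := IHl (path_sorted sl) (is_partition_behead Pl).
rewrite /=; case: i => [|i]; rewrite ?part_cons0 ?part_consS.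
  by case: (ltnP j a) => // aj; rewrite add0n IHl; have := le_a 0; lia.
case: (ltnP j a) => aj; first by rewrite add1n ltnS IHl.
by rewrite add0n IHl; have := le_a i; have := le_a i.+1; lia.
Qed.

Lemma conj_part_leq_size l j : conj_part l j <= size l.
Proof. exact: count_size. Qed.

Lemma conj_part0 l : is_partition l -> conj_part l 0 = size l.
Proof. by case/andP=> _; rewrite all_count => /eqP. Qed.

(* [nu / l] is a horizontal strip. *)
Definition interlaced (l nu : seq nat) : Prop :=
  forall s, part nu s.+1 <= part l s <= part nu s.

Lemma interlaced_subdiag l nu : interlaced l nu -> subdiag l nu.
Proof. by move=> il; apply/subdiagP => s; case/andP: (il s). Qed.

Lemma interlaced_behead_subdiag l nu : interlaced l nu -> subdiag (behead nu) l.
Proof.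
by move=> il; apply/subdiagP => s; rewrite part_behead; case/andP: (il s).
Qed.

Lemma hstrip_consE a l nu : is_partition (a :: l) -> is_partition nu ->
  hstrip (a :: l) nu <-> part nu 0 <= a /\ interlaced l nu.
Proof.
move=> Pal Pnu; have Pl : is_partition l := is_partition_behead Pal.
have le_a s : part l s <= a := @leq_part _ 0 s.+1 Pal (leq0n _).
have columnE j : count (fun i => (part nu i <= j) && (j < part (a :: l) i))
    (iota 0 (size (a :: l))) = conj_part (a :: l) j - conj_part nu j.
  rewrite -(@count_iota_interval _ _ (size (a :: l))) ?conj_part_leq_size //.
  by apply: eq_count => i; rewrite leqNgt -!ltn_conj_part // -leqNgt.
split=> [/andP[/subdiagP sub /allP col]|[nu0a il]].
  split=> [|s]; first exact: (sub 0).
  have -> : part nu s.+1 <= part l s := sub s.+1.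
  rewrite leqNgt; apply/negP => lt_s; have ja := leq_trans lt_s (le_a s).
  have := col (part nu s); rewrite mem_iota ja columnE => /(_ isT).
  rewrite {1}/conj_part /= ja -/(conj_part l (part nu s)).
  have := ltn_conj_part s (part nu s) Pl.
  have := ltn_conj_part s (part nu s) Pnu.
  by rewrite lt_s; lia.
apply/andP; split; first by apply/subdiagP => -[//|s]; case/andP: (il s).
apply/allP => j; rewrite mem_iota => /andP[_ ja]; rewrite columnE.
rewrite {1}/conj_part /= (ja : j < a) -/(conj_part l j) leq_subLR.
rewrite [_ + 1]addnC leq_add2l leqNgt.
apply/negP => lt_conj; have := ltn_conj_part (conj_part nu j) j Pl.
have := ltn_conj_part (conj_part nu j) j Pnu.
by rewrite lt_conj ltnn; case/andP: (il (conj_part nu j)); lia.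
Qed.

Lemma mem_cells l i j : ((i, j) \in cells l) = (j < part l i).
Proof.
apply/allpairsPdep/idP => [[x [y [_ + [-> ->]]]]|jl].
  by rewrite mem_iota.
exists i, j; rewrite !mem_iota jl; split=> //=.
by rewrite ltnNge; apply: contraTN jl => li; rewrite /part nth_default.
Qed.

Lemma hook_consS a l i j : j < a -> hook (a :: l) i.+1 j = hook l i j.
Proof. by rewrite /hook /conj_part /= => ->; rewrite add1n subSS. Qed.

Lemma hook_cons0 a l j : j < a -> hook (a :: l) 0 j = a - j + conj_part l j.
Proof. by rewrite /hook /conj_part /= => ja; rewrite ja; lia. Qed.

Lemma hook_leq_sumn l i j :
  is_partition l -> j < part l i -> hook l i j <= sumn l.
Proof.
elim: l i => [|a l IHl] i Pal; first by rewrite part_nil.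
have Pl : is_partition l := is_partition_behead Pal.
case: i => [|i]; rewrite ?part_cons0 ?part_consS => jl.
  rewrite hook_cons0 //= leq_add ?leq_subr //.
  exact: leq_trans (conj_part_leq_size _ _) (size_leq_sumn Pl).
rewrite hook_consS; last exact: leq_trans jl (@leq_part _ 0 i.+1 Pal isT).
exact: leq_trans (IHl i Pl jl) (leq_addl _ _).
Qed.

(** * Cores with one long row *)

Definition row_deg k l i :=
  count (fun j => hook l i j <= k) (iota 0 (part l i)).

Lemma degE k l : deg k l = sumn [seq row_deg k l i | i <- iota 0 (size l)].
Proof.
rewrite /deg /cells count_flatten -map_comp; congr sumn.
by apply: eq_map => i /=; rewrite count_map.
Qed.

Lemma row_deg_small k l i :
  is_partition l -> sumn l <= k -> row_deg k l i = part l i.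
Proof.
move=> Pl lk; rewrite -[RHS](size_iota 0); apply/eqP; rewrite -all_count.
apply/allP => j; rewrite mem_iota => /andP[_ jl].
exact: leq_trans (hook_leq_sumn Pl jl) lk.
Qed.

Lemma row_degs_small k l : is_partition l -> sumn l <= k ->
  [seq row_deg k l i | i <- iota 0 (size l)] = l.
Proof.
move=> Pl lk; rewrite -[RHS](mkseq_nth 0).
by apply: eq_map => i; apply: row_deg_small.
Qed.

Lemma kshape_small k l : is_partition l -> sumn l <= k -> kshape k l = l.
Proof.
move=> Pl lk; rewrite /kshape -/(row_deg k l) row_degs_small //.
by apply/all_filterP; case/andP: Pl.
Qed.

Lemma deg_small k l : is_partition l -> sumn l <= k -> deg k l = sumn l.
Proof. by move=> Pl lk; rewrite degE row_degs_small. Qed.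

Lemma is_core_small k l : is_partition l -> sumn l <= k -> is_core k l.
Proof.
move=> Pl lk; rewrite /is_core Pl; apply/allP => -[i j].
rewrite mem_cells => jl; rewrite neq_ltn ltnS.
by rewrite (leq_trans (hook_leq_sumn Pl jl) lk).
Qed.

Lemma row_deg_consS k a l i :
  is_partition (a :: l) -> row_deg k (a :: l) i.+1 = row_deg k l i.
Proof.
move=> Pal; rewrite /row_deg part_consS; apply: eq_in_count => j.
rewrite mem_iota => /andP[_ jl]; rewrite hook_consS //.
exact: leq_trans jl (@leq_part _ 0 i.+1 Pal isT).
Qed.

Lemma deg_cons k a l : is_partition (a :: l) -> sumn l <= k ->
  deg k (a :: l) = row_deg k (a :: l) 0 + sumn l.
Proof.
move=> Pal lk; have Pl : is_partition l := is_partition_behead Pal.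
rewrite -(deg_small Pl lk) !degE /=; congr (_ + sumn _).
by rewrite (iotaDl 1) -map_comp; apply: eq_map => i; apply: row_deg_consS.
Qed.

(* A first row of length [a] over a small partition [l] avoids the hook length
   k+1 exactly when [a - k - 1] is not in the Maya diagram {j - l'_j}, that is,
   when it equals [l_i - i] for some i >= 1; below, d = k + 1 - i. *)
Definition long_core k d l : seq nat := (d + part l (k - d)) :: l.

Lemma bump_long_core k l : bump k l = long_core k k l.
Proof. by rewrite /long_core subnn. Qed.

Lemma long_core_small k nu :
  is_partition nu -> nu != [::] -> sumn nu <= k ->
  long_core k (part nu 0) (behead nu) = nu.
Proof.
case: nu => //= a r Par _ ark; congr cons.
by rewrite part_geq_sumn ?addn0 ?(is_partition_behead Par) //; lia.
Qed.

Section LongCore.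
Variables (k d : nat) (l : seq nat).
Hypotheses (Pg : is_partition (long_core k d l)) (lk : sumn l <= k).
Hypothesis dk : d <= k.

Let Pl : is_partition l := is_partition_behead Pg.

Lemma hook_long_core j : j < d + part l (k - d) ->
  if j < part l (k - d) then k.+1 < hook (long_core k d l) 0 j
  else hook (long_core k d l) 0 j <= k.
Proof.
move=> ja; rewrite hook_cons0 //; have := ltn_conj_part (k - d) j Pl.
by case: (ltnP j (part _ _)); lia.
Qed.

Lemma is_core_long_core : is_core k (long_core k d l).
Proof.
rewrite /is_core Pg; apply/allP => -[[|i] j]; rewrite mem_cells => jl /=.
  by have := hook_long_core jl; case: ifP; lia.
rewrite hook_consS; last exact: leq_trans jl (@leq_part _ 0 i.+1 Pg isT).
by have := hook_leq_sumn Pl jl; lia.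
Qed.

Lemma row_deg_long_core : row_deg k (long_core k d l) 0 = d.
Proof.
rewrite /row_deg part_cons0 -[RHS](addnK (part l (k - d))).
rewrite -[RHS](count_iota_interval _ (leqnn _)); apply: eq_in_count => j.
rewrite mem_iota => /andP[_ jl]; rewrite (jl : j < _) andbT.
by have := hook_long_core jl; case: (ltnP j (part _ _)); lia.
Qed.

Lemma deg_long_core : deg k (long_core k d l) = d + sumn l.
Proof. by rewrite deg_cons // row_deg_long_core. Qed.
End LongCore.

Lemma core_row0_eq k a l : is_core k (a :: l) -> sumn l <= k ->
  exists2 d, d <= k & a = d + part l (k - d).
Proof.
case/andP=> Pal /allP hooks lk.
have Pl : is_partition l := is_partition_behead Pal.
pose fits d := (d <= k) && (d + part l (k - d) <= a).
have fits0 : exists d, fits d by exists 0; rewrite /fits subn0 part_geq_sumn.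
have fits_leq d : fits d -> d <= k by case/andP.
case: (ex_maxnP fits0 fits_leq) => d /andP[dk da] d_max; exists d => //.
apply/eqP; rewrite eqn_leq da andbT leqNgt; apply/negP => lt_a.
have ja : a - d.+1 < a by lia.
have := hooks (0, a - d.+1); rewrite mem_cells => /(_ ja) /=.
rewrite hook_cons0 // => /eqP; apply.
suff -> : conj_part l (a - d.+1) = k - d by lia.
apply/eqP; rewrite eqn_leq leqNgt ltn_conj_part // -leqNgt.
apply/andP; split; first lia.
case: (posnP (k - d)) => [-> // | kd]; rewrite -(prednK kd) ltn_conj_part //.
have : ~~ fits d.+1 by apply/negP => /d_max; rewrite ltnn.
by rewrite /fits -subnS; lia.
Qed.

Lemma core_eq_long_core k g (d := row_deg k g 0) :
  is_core k g -> g != [::] -> sumn (behead g) <= k ->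
  d <= k /\ g = long_core k d (behead g).
Proof.
case: g @d => // a l d Cal _ lk; have /andP[Pal _] := Cal.
case: (core_row0_eq Cal lk) => e ek aE.
have gE : a :: l = long_core k e l by rewrite /long_core -aE.
suff -> : d = e by [].
by rewrite /d gE row_deg_long_core // -gE.
Qed.

Definition strip_step k d l d' l' : Prop :=
  (d' = d.+1 /\ l' = l) \/
  (d' = d /\ forall s, part l' s = part l s + (s == k - d)).

Lemma strip_step_sumn k d l d' l' :
  strip_step k d l d' l' -> d' + sumn l' = (d + sumn l).+1.
Proof.
case=> -[-> addE]; first by rewrite addE addSn.
by rewrite (sumn_add_cell addE) addnS.
Qed.

Section LongCoreCover.
Variables (k d d' : nat) (l l' : seq nat).
Hypotheses (Pg : is_partition (long_core k d l)) (lk : sumn l <= k).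
Hypotheses (Pg' : is_partition (long_core k d' l')) (lk' : sumn l' <= k).
Hypotheses (dk : d <= k) (dk' : d' <= k).

(* If [d' < d], the rows k - d and k - d' would each have to absorb all the
   added cells. *)
Lemma strong_cover_strip_step :
  strong_cover k (long_core k d l) (long_core k d' l') ->
  d + part l (k - d) < d' + part l' (k - d') -> strip_step k d l d' l'.
Proof.
have Pl : is_partition l := is_partition_behead Pg.
have Pl' : is_partition l' := is_partition_behead Pg'.
case/and4P=> _ _ /subdiagP sub_core.
rewrite !deg_long_core // => /eqP degS lt_row0.
have sub i : part l i <= part l' i := sub_core i.+1.
have sub_ll' : subdiag l l' by apply/subdiagP.
have le_sumn := sumn_subdiag sub_ll'.
case: (ltngtP d d') => dd'.
- by left; split; [lia | apply/esym/subdiag_sumn_eq => //; lia].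
- have := @sumn_subdiag_row2 _ _ (k - d) (k - d') sub_ll'.
  have := @leq_part l (k - d) (k - d') Pl.
  by have := @leq_part l' (k - d) (k - d') Pl'; lia.
right; split=> // s; case: eqP => [-> | /eqP ne].
  by have := sumn_subdiag_row (k - d) sub_ll'; rewrite -dd' in lt_row0; lia.
have := sumn_subdiag_row2 sub_ll' ne; have := sub s.
by rewrite -dd' in lt_row0; lia.
Qed.

Lemma strip_step_strong_cover : strip_step k d l d' l' ->
  strong_cover k (long_core k d l) (long_core k d' l') /\
  d + part l (k - d) < d' + part l' (k - d').
Proof.
have Pl : is_partition l := is_partition_behead Pg.
move=> step; have sub i : part l i <= part l' i.
  by case: step => -[_ ->] //; apply: leq_addr.
have lt_row0 : d + part l (k - d) < d' + part l' (k - d').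
  case: step => -[-> addE]; last by rewrite addE eqxx addn1 addnS.
  by rewrite addE addSn ltnS leq_add2l leq_part // leq_sub2l.
split=> //; rewrite /strong_cover !is_core_long_core // !deg_long_core //.
rewrite (strip_step_sumn step).
by rewrite eqxx andbT; apply/subdiagP => -[|i]; [apply: ltnW | apply: sub].
Qed.
End LongCoreCover.

(** * Chains of bottom strong strips *)

Section StripSteps.
Variables (k m : nat) (d : nat -> nat) (r : nat -> seq nat).
Hypothesis steps :
  forall j, j < m -> strip_step k (d j) (r j) (d j.+1) (r j.+1).

Lemma strip_steps_lower_rows j s :
  j <= m -> s < k - d j -> part (r j) s = part (r 0) s.
Proof.
elim: j => // j IHj jm sd; case: (steps jm) => -[dE rE].
  by rewrite rE IHj; lia.
by rewrite rE IHj -?dE ?(ltn_eqF sd) ?addn0 // ltnW.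
Qed.

Lemma strip_steps_upper_rows j s :
  j <= m -> k - d j < s -> part (r j) s = part (r m) s.
Proof.
move=> jm; have [t] := ubnP (m - j); elim: t j jm => // t IHt j jm mj sd.
case: (ltngtP j m) jm => // [jm _ | -> //].
have IHS : k - d j.+1 < s -> part (r j.+1) s = part (r m) s.
  by apply: IHt => //; lia.
case: (steps jm) => -[dE rE]; rewrite dE rE in IHS; first by apply: IHS; lia.
by rewrite -IHS // (gtn_eqF sd) addn0.
Qed.

Lemma strip_steps_crossing e : d 0 <= e < d m ->
  exists2 j, j < m & d j = e /\ d j.+1 = e.+1.
Proof.
elim: m steps => [|n IHn] stepsn; first lia.
move=> /andP[d0 en]; case: (ltnP e (d n)) => e_dn.
  have [|j jn dj] := IHn (fun j jn => stepsn j (leqW jn)); first by rewrite d0.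
  by exists j => //; apply: leqW.
by exists n => //; case: (stepsn n (ltnSn _)) => -[dE _]; lia.
Qed.
End StripSteps.

Section Strip.
Variables (k m : nat) (l nu : seq nat) (ch : seq (seq nat)).
Hypotheses (k0 : 0 < k) (Pl : is_partition l) (lk : sumn l <= k).
Hypotheses (Cnu : is_core k nu) (mk : m < k).
Hypothesis chain : bstrip_chain k nu (bump k l) m ch.
Local Notation g j := (nth [::] ch j).
Local Notation d j := (row_deg k (g j) 0).

Let Pbump : is_partition (long_core k k l).
Proof. by rewrite is_partition_cons subnn Pl; lia. Qed.

Lemma chain_first : g 0 = nu. Proof. by case: chain. Qed.

Lemma chain_last : g m = bump k l. Proof. by case: chain. Qed.

Lemma chain_cover j : j < m ->
  strong_cover k (g j) (g j.+1) /\ part (g j) 0 < part (g j.+1) 0.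
Proof. by move=> jm; case: chain => _ _ _ _ /(_ j.+1 jm). Qed.

Lemma chain_core j : j <= m -> is_core k (g j).
Proof.
case: j => [|j] jm; first by rewrite chain_first.
by have [/and4P[]] := chain_cover jm.
Qed.

Lemma chain_deg j : j <= m -> deg k (g j) = deg k nu + j.
Proof.
elim: j => [|j IHj] jm; first by rewrite chain_first addn0.
have [/and4P[_ _ _ /eqP-> _]] := chain_cover jm.
by rewrite IHj ?addnS // ltnW.
Qed.

Lemma strip_deg : deg k nu + m = sumn l + k.
Proof.
by rewrite -chain_deg // chain_last bump_long_core deg_long_core // addnC.
Qed.

Lemma chain_neq0 j : j <= m -> g j != [::].
Proof.
move=> jm; apply/eqP => gj0; have := chain_deg jm.
by rewrite gj0 [LHS]deg_small //=; have := strip_deg; lia.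
Qed.

Lemma chain_subdiag j : j <= m -> subdiag (g j) (bump k l).
Proof.
move=> jm; have [t] := ubnP (m - j); elim: t j jm => // t IHt j jm mj.
case: (ltngtP j m) jm => // [jm _ | -> _]; last first.
  by rewrite chain_last; apply/subdiagP.
have [/and4P[_ _ /subdiagP sub _] _] := chain_cover jm.
have /subdiagP subS : subdiag (g j.+1) (bump k l) by apply: IHt => //; lia.
by apply/subdiagP => i; apply: leq_trans (sub i) (subS i).
Qed.

Lemma chain_behead_leq j : j <= m -> sumn (behead (g j)) <= k.
Proof.
move/chain_subdiag/subdiagP=> sub; apply: leq_trans lk; apply: sumn_subdiag.
by apply/subdiagP => i; rewrite part_behead; apply: (sub i.+1).
Qed.

Lemma chain_long_core j :
  j <= m -> d j <= k /\ g j = long_core k (d j) (behead (g j)).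
Proof.
move=> jm; apply: core_eq_long_core; first exact: chain_core.
  exact: chain_neq0.
exact: chain_behead_leq.
Qed.

Lemma chain_row0 j :
  j <= m -> part (g j) 0 = d j + part (g j) (k - d j).+1.
Proof. by move=> jm; rewrite -part_behead {1}(chain_long_core jm).2. Qed.

Lemma chain_strip_step j : j < m ->
  strip_step k (d j) (behead (g j)) (d j.+1) (behead (g j.+1)).
Proof.
move=> jm; have [cov lt_row0] := chain_cover jm.
have [dk gE] := chain_long_core (ltnW jm); have [dk' g'E] := chain_long_core jm.
rewrite gE g'E in cov lt_row0; have /and4P[Cg Cg' _ _] := cov.
apply: strong_cover_strip_step => //; try exact: chain_behead_leq.
- by case/andP: Cg.
- exact/chain_behead_leq/ltnW.
- by case/andP: Cg'.
Qed.

Lemma strip_interlaced : interlaced l nu.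
Proof.
have Pnu : is_partition nu by case/andP: Cnu.
case: chain => _ _ _ /(hstrip_consE _ Pnu)[] //.
by rewrite -/(bump k l) bump_long_core.
Qed.

Lemma part0_raise_step j s :
  j < m -> 0 < s <= k -> d j = k - s -> d j.+1 = (d j).+1 ->
  part (g j) 0 = k - s + part l s /\ part (g j.+1) 0 = (k - s).+1 + part nu s.
Proof.
move=> jm sk dj djS; have steps := chain_strip_step.
have jm' : j <= m := ltnW jm.
have ks : k - (k - s) = s by lia.
have ksS : (k - (k - s).+1).+1 = s by lia.
rewrite !chain_row0 // djS dj ks ksS; split; congr (_ + _).
  case: (steps j jm) => [[_ rE] | [dE _]]; last by move: dE; lia.
  rewrite -part_behead -rE (strip_steps_upper_rows steps jm) ?djS ?dj; last lia.
  by rewrite part_behead chain_last.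
case: (steps j jm) => [[_ rE] | [dE _]]; last by move: dE; lia.
rewrite -ksS -part_behead rE (strip_steps_lower_rows steps jm') ?dj; last lia.
by rewrite part_behead chain_first.
Qed.

Lemma part0_add_step j :
  j < m -> d j.+1 = d j -> part (g j.+1) 0 = (part (g j) 0).+1.
Proof.
move=> jm djS; case: (chain_strip_step jm) => -[dE rE]; first by move: dE; lia.
rewrite !chain_row0 ?djS //; last exact: ltnW.
by rewrite -!part_behead rE eqxx addn1 addnS.
Qed.

Lemma strip_inner :
  deg k nu <= k -> row_deg k nu 0 = part nu 0 /\ deg k nu = sumn nu.
Proof.
move=> nuk; have Pnu : is_partition nu by case/andP: Cnu.
have := chain_row0 (leq0n m); have := chain_behead_leq (leq0n m).
have := chain_neq0 (leq0n m); rewrite chain_first -part_behead.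
case: nu Pnu nuk => // a r Par ark _ rk aE; rewrite deg_cons // in ark *.
suff row0_end : part r (k - row_deg k (a :: r) 0) = 0.
  have row_degE : row_deg k (a :: r) 0 = a.
    by rewrite -[RHS](part_cons0 a r) aE row0_end addn0.
  by rewrite row_degE.
by apply: part_geq_sumn; [apply: is_partition_behead Par | lia].
Qed.

(* Non-tail cells come only from the steps which raise the degree of the first
   row; the one leaving the degree k - s yields the cells of row s of nu / l. *)
Lemma strip_nontail x : deg k nu <= k ->
  (exists2 j, 0 < j <= m & (part (g j.-1) 0).+2 <= x <= part (g j) 0) <->
  (exists s c, [/\ 0 < s, part l s <= c < part nu s & x + s = k + 2 + c]).
Proof.
move=> nuk; have [d0 nuE] := strip_inner nuk.
have Pnu : is_partition nu by case/andP: Cnu.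
split=> [[[//|j] jm] | [s [c [s0 /andP[lc cnu] xs]]]].
  have [dk _] := chain_long_core jm; rewrite [j.+1.-1]/=.
  case: (chain_strip_step jm) => -[djS _]; last first.
    by rewrite (part0_add_step jm djS); lia.
  have [|||gj gjS] := @part0_raise_step j (k - d j) jm; try lia.
  rewrite gj gjS => xj.
  by exists (k - d j), (x + (k - d j) - (k + 2)); split; lia.
have s_bound := part0D_leq_sumn Pnu (leq_ltn_trans (leq0n _) cnu).
have [|j jm [dj djS]] := strip_steps_crossing chain_strip_step (e := k - s).
  rewrite chain_first chain_last d0 bump_long_core row_deg_long_core //.
  by lia.
have [|||gj gjS] := @part0_raise_step j s jm; try lia.
by exists j.+1; rewrite // [j.+1.-1]/= gj gjS; lia.
Qed.
End Strip.

(* A chain completes the rows of [r] to those of [l] from the top row down; the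
   row [k - d] is the one being completed. *)
Definition partial_strip k l d r : Prop :=
  [/\ is_partition (long_core k d r), subdiag r l, 0 < d <= k,
      forall i, k - d < i -> part r i = part l i &
      forall i, i < k - d -> part l i.+1 <= part r i].

Section PartialStrip.
Variables (k d : nat) (l r : seq nat).
Hypotheses (Pl : is_partition l) (strip : partial_strip k l d r).

Let Pr : is_partition r.
Proof. by case: strip => /is_partition_behead. Qed.

Lemma partial_strip_add : part r (k - d) < part l (k - d) ->
  partial_strip k l d (incr_nth r (k - d)).
Proof.
case: strip => Pg /subdiagP sub dk high low lt_l.
set t := k - d in high low lt_l *.
have partE i : part (incr_nth r t) i = (t == i) + part r i.
  exact: nth_incr_nth.
have part_dec i : part (incr_nth r t) i.+1 <= part (incr_nth r t) i.
  rewrite !partE; have := leq_partS i Pr; case: (ltngtP t i.+1) => ti; try lia.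
  have := low i; have := leq_partS i Pl; rewrite -ti; lia.
have part_pos i : i < size (incr_nth r t) -> 0 < part (incr_nth r t) i.
  rewrite size_incr_nth partE addn_gt0 part_gt0 // => it.
  case: (ltnP i (size r)) => [_ | ri]; first by rewrite orbT.
  move: it; case: ifP => _ it; first lia.
  case: (ltngtP t i) => // ti; first lia.
  have := low i ti; have := @leq_part l i.+1 t Pl ti.
  by have := part_gt0 i Pr; lia.
split=> //.
- move: Pg; rewrite is_partition_cons -/t => /and3P[_ r0 _].
  by rewrite is_partition_cons is_partitionI // -/t !partE eqxx; lia.
- apply/subdiagP => i; rewrite partE.
  by case: eqP => [<- | _]; rewrite ?add1n ?add0n.
- by move=> i ti; rewrite partE (ltn_eqF ti) high.
by move=> i it; rewrite partE; apply: leq_trans (low i it) (leq_addl _ _).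
Qed.

Lemma partial_strip_raise : part r (k - d) = part l (k - d) -> d < k ->
  partial_strip k l d.+1 r.
Proof.
case: strip => Pg sub /andP[d0 _] high low eq_l dk.
have rkd : part r (k - d) <= part r (k - d.+1) by rewrite leq_part // leq_sub2l.
split=> //.
- by move: Pg; rewrite !is_partition_cons Pr; lia.
- move=> i ki; case: (eqVneq i (k - d)) => [-> // | ne]; apply: high; lia.
by move=> i ik; apply: low; lia.
Qed.

Lemma partial_strip_next : d + sumn r < k + sumn l ->
  exists d' r', partial_strip k l d' r' /\ strip_step k d r d' r'.
Proof.
case: (strip) => _ sub dk high _ lt_sum; have /subdiagP/(_ (k - d)) := sub.
rewrite leq_eqVlt => /predU1P[eq_l | lt_l]; last first.
  exists d, (incr_nth r (k - d)); split; first exact: partial_strip_add.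
  by right; split=> // s; rewrite /part nth_incr_nth eq_sym addnC.
case: (ltnP d k) => [d_lt_k | kd].
  by exists d.+1, r; split; [apply: partial_strip_raise | left].
suff rl : r = l by move: lt_sum; rewrite rl; lia.
apply: eq_from_part => // i; case: (posnP i) => [-> | i0].
  by move: eq_l; have -> : k - d = 0 by lia.
by apply: high; lia.
Qed.
End PartialStrip.

Lemma partial_strip_chain k l m d r : is_partition l -> sumn l <= k ->
  partial_strip k l d r -> m + (d + sumn r) = k + sumn l ->
  exists2 ch, [/\ size ch = m.+1, nth [::] ch 0 = long_core k d r
                & nth [::] ch m = bump k l]
    & forall j, 0 < j <= m ->
        strong_cover k (nth [::] ch j.-1) (nth [::] ch j) /\
        part (nth [::] ch j.-1) 0 < part (nth [::] ch j) 0.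
Proof.
move=> Pl lk; elim: m d r => [|m IHm] d r strip sumE.
  have [Pg sub dk _ _] := strip; have le_sum := sumn_subdiag sub.
  have -> : r = l.
    by apply: subdiag_sumn_eq => //; [apply: is_partition_behead Pg | lia].
  exists [:: bump k l] => [|[]] //; rewrite bump_long_core.
  by have -> : d = k by lia.
have [|d' [r' [strip' step]]] := partial_strip_next Pl strip; first lia.
have [Pg sub dk _ _] := strip; have [Pg' sub' dk' _ _] := strip'.
have rk := leq_trans (sumn_subdiag sub) lk.
have r'k := leq_trans (sumn_subdiag sub') lk.
have [||cov lt_row0] := strip_step_strong_cover Pg rk Pg' r'k _ _ step.
- by case/andP: dk.
- by case/andP: dk'.
have [|ch [size_ch ch0 chm] covers] := IHm d' r' strip'.
  by rewrite (strip_step_sumn step); lia.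
exists (long_core k d r :: ch); first by rewrite /= size_ch.
by case=> [//|[|j]] jm; [rewrite /= ch0 | apply: (covers j.+1)].
Qed.

Lemma partial_strip_small k l nu :
  is_partition nu -> nu != [::] -> sumn nu <= k -> interlaced l nu ->
  partial_strip k l (part nu 0) (behead nu).
Proof.
move=> Pnu nu0 nuk il; have nu_pos : 0 < part nu 0.
  by rewrite part_gt0 // lt0n size_eq0.
have le_row0 := part0D_leq_sumn Pnu nu_pos.
have /subdiagP sub := interlaced_subdiag il.
split; first by rewrite long_core_small.
- exact: interlaced_behead_subdiag.
- lia.
- move=> i ki; have nu_i := part0D_leq_sumn (i := i) Pnu.
  by have := sub i; have := leq_partS i Pnu; rewrite part_behead; lia.
by move=> i _; rewrite part_behead; case/andP: (il i.+1).
Qed.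

Lemma bottom_strong_stripP k l nu m :
  is_partition l -> 0 < m -> sumn l + m <= k ->
  bottom_strong_strip k nu (bump k l) (k - m) <->
  [/\ is_partition nu, sumn nu = sumn l + m & interlaced l nu].
Proof.
move=> Pl m0 lmk; have k0 : 0 < k by lia.
have lk : sumn l <= k by lia.
split=> [[Cnu _ _ [ch chain]] | [Pnu nuE il]].
  have mk : k - m < k by lia.
  have degE := strip_deg k0 Pl lk Cnu mk chain.
  have [|_ nuE] := strip_inner k0 Pl lk Cnu mk chain; first lia.
  by split; [case/andP: Cnu | lia | apply: strip_interlaced chain].
have nuk : sumn nu <= k by lia.
have nu0 : nu != [::] by case: (nu) nuE => //=; lia.
have Pbump : is_partition (long_core k k l).
  by rewrite is_partition_cons subnn Pl; lia.
have [|ch [size_ch ch0 chm] covers] :=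
  partial_strip_chain (m := k - m) Pl lk (partial_strip_small Pnu nu0 nuk il).
  by case: (nu) nu0 nuE => //= a r _; lia.
split; [exact: is_core_small | | lia | exists ch; split=> //].
- by rewrite bump_long_core is_core_long_core.
- by rewrite ch0 long_core_small.
rewrite bump_long_core; apply/hstrip_consE => //; split=> //.
by case: (nu) nuk => //= a r; lia.
Qed.

(** * Non-tail cells of the extended rows *)

Section RowOfABC.
Variables (k i : nat) (mu : seq nat) (A : seq (seq nat)).
Local Notation l := (nth [::] A i.-1).
Local Notation nu := (nth [::] A i).
Local Notation m := (nth 0 mu i.-1).
Hypotheses (Pl : is_partition l) (l0 : 0 < sumn l) (m0 : 0 < m).
Hypothesis lmk : sumn l + m <= k.
Hypothesis strip : bottom_strong_strip k nu (bump k l) (k - m).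

Lemma row_chainP : bstrip_chain k nu (bump k l) (k - m) (row_chain k mu A i).
Proof. by case: strip => _ _ _; apply: epsilon_spec. Qed.

Lemma brk_first : brk k mu A i 0 = part nu 0.
Proof. by rewrite /brk (chain_first row_chainP). Qed.

Lemma brk_last : brk k mu A i (k - m) = k + part l 0.
Proof. by rewrite /brk (chain_last row_chainP). Qed.

Lemma brk_ltS j : j < k - m -> brk k mu A i j < brk k mu A i j.+1.
Proof. by case/(chain_cover row_chainP). Qed.

Lemma ribbon_sizesE : ribbon_sizes k mu A i =
  [seq brk k mu A i j.+1 - brk k mu A i j | j <- iota 0 (k - m)].
Proof. by rewrite /ribbon_sizes (iotaDl 1) -map_comp. Qed.

Lemma s_rowE : s_row k mu A i = k + part l 0 - part nu 0.
Proof.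
rewrite /s_row ribbon_sizesE sumnE big_map -brk_first -brk_last.
have <- := telescope_sumn_in (f := brk k mu A i) (leq0n (k - m)).
  by rewrite /index_iota subn0.
by move=> j /andP[_ jm]; apply/ltnW/brk_ltS.
Qed.

Lemma r_rowE : r_row k mu A i = k - m.
Proof.
rewrite /r_row ribbon_sizesE count_map -[RHS](size_iota 0); apply/eqP.
rewrite -all_count; apply/allP => j; rewrite mem_iota => /andP[_ jm] /=.
by rewrite subn_gt0 brk_ltS.
Qed.

Lemma ext_lenE : ext_len k mu A i = (part nu 0 - part l 0).+1.
Proof.
have [Pnu nuE il] := (bottom_strong_stripP nu Pl m0 lmk).1 strip.
have := sumn_subdiag_row 0 (interlaced_subdiag il).
by rewrite /ext_len s_rowE r_rowE; have := il 0; lia.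
Qed.

Lemma mem_ribbon_nontail x :
  (x \in flatten [seq iota (brk k mu A i j.-1).+2
                          (brk k mu A i j - brk k mu A i j.-1).-1
                 | j <- iota 1 (k - m)]) <->
  (exists s c, [/\ 0 < s, part l s <= c < part nu s & x + s = k + 2 + c]).
Proof.
have [Pnu nuE il] := (bottom_strong_stripP nu Pl m0 lmk).1 strip.
have k0 : 0 < k by lia.
have [lk mk nuk] : [/\ sumn l <= k, k - m < k & sumn nu <= k].
  by split; lia.
have degk : deg k nu <= k by rewrite deg_small.
have Cnu := is_core_small Pnu nuk.
rewrite -(strip_nontail k0 Pl lk Cnu mk row_chainP _ degk).
split=> [/flatten_mapP[j] | [j jm xj]].
  by rewrite !mem_iota => jm xj; exists j; rewrite /brk in xj *; lia.
by apply/flatten_mapP; exists j; rewrite mem_iota /brk; lia.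
Qed.

Lemma mem_Vrow x : (x \in Vrow k mu A i) <->
  (exists s c, part l s <= c < part nu s /\ x + s = k + 2 + c).
Proof.
have len_rowE : len_row k A i = k + part l 0 by [].
rewrite /Vrow mem_cat ext_lenE len_rowE mem_iota; split.
  case/orP=> [/mem_ribbon_nontail[s [c [_ sc xE]]] | xE]; first by exists s, c.
  by exists 0, (x - (k + 2)); lia.
case=> [[|s] [c [sc xE]]]; apply/orP; last first.
  by left; apply/mem_ribbon_nontail; exists s.+1, c.
by right; lia.
Qed.
End RowOfABC.

(** * Cyclic scans *)

Section Scan.
Variable T : eqType.
Implicit Types (cut : rel T) (p q x y : T) (ps s : seq T).

(* The first element of [s] met when scanning cyclically to the left of [p]. *)
Definition scan_left cut p s := last (last p s) [seq q <- s | cut q p].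

Fixpoint greedy_match cut ps s :=
  match ps, s with
  | p :: ps', _ :: _ =>
      let q := scan_left cut p s in q :: greedy_match cut ps' (rem q s)
  | _, _ => [::]
  end.

Lemma greedy_match_nil cut ps : greedy_match cut ps [::] = [::].
Proof. by case: ps. Qed.

Lemma greedy_match_cons cut p ps s (q := scan_left cut p s) : s != [::] ->
  greedy_match cut (p :: ps) s = q :: greedy_match cut ps (rem q s).
Proof. by case: s @q. Qed.

Variant scan_left_spec cut p s : T -> Type :=
  | ScanLeftBelow of has (cut^~ p) s :
      scan_left_spec cut p s (last p [seq q <- s | cut q p])
  | ScanLeftAround of ~~ has (cut^~ p) s : scan_left_spec cut p s (last p s).

Lemma last_in x s : s != [::] -> last x s \in s.
Proof. by case: s => // y s _; rewrite /= mem_last. Qed.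

Lemma scan_leftP cut p s : scan_left_spec cut p s (scan_left cut p s).
Proof.
rewrite /scan_left; have [has_s | no_s] := boolP (has (cut^~ p) s).
  have := has_s; rewrite has_filter.
  case belowE: [seq q <- s | cut q p] => [//|z t] _.
  by rewrite /= -[last z t]/(last p (z :: t)) -belowE; left.
have -> : [seq q <- s | cut q p] = [::].
  by apply/eqP; rewrite -[_ == _]negbK -has_filter.
by rewrite /=; right.
Qed.

Lemma scan_left_mem cut p s : s != [::] -> scan_left cut p s \in s.
Proof.
case: scan_leftP => [|_]; last exact: last_in.
by rewrite has_filter => /(last_in p); rewrite mem_filter => /andP[].
Qed.

Lemma scan_left_cut cut p s y :
  y \in s -> cut y p -> cut (scan_left cut p s) p.
Proof.
move=> ys yp; case: scan_leftP => [|/hasPn/(_ y ys)/negP//].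
by rewrite has_filter => /(last_in p); rewrite mem_filter => /andP[].
Qed.

Lemma eq_scan_left cut cut' p s :
  {in s, cut^~ p =1 cut'^~ p} -> scan_left cut p s = scan_left cut' p s.
Proof. by move=> eq_cut; rewrite /scan_left (eq_in_filter eq_cut). Qed.

Lemma size_greedy_match cut ps s :
  size (greedy_match cut ps s) = minn (size ps) (size s).
Proof.
elim: ps s => [|p ps IHps] s; first by rewrite min0n.
have [-> | s0] := eqVneq s [::]; first by rewrite minn0.
rewrite greedy_match_cons //= IHps size_rem ?scan_left_mem //.
by case: s s0 => //= a s _; rewrite minnSS.
Qed.

Lemma perm_greedy_match cut ps s :
  size s <= size ps -> perm_eq (greedy_match cut ps s) s.
Proof.
elim: ps s => [|p ps IHps] s; first by case: s.
have [-> // | s0] := eqVneq s [::]; rewrite greedy_match_cons // => le_size.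
have qs := scan_left_mem cut p s0.
rewrite perm_sym (permPl (perm_to_rem qs)) perm_cons perm_sym IHps //.
by rewrite size_rem //; case: (size s) le_size.
Qed.

Section StrictOrder.
Variable lt : rel T.
Hypotheses (lt_irr : irreflexive lt) (lt_trans : transitive lt).

Lemma pairwise_rem q s : pairwise lt s -> pairwise lt (rem q s).
Proof. exact: subseq_pairwise (rem_subseq _ _). Qed.

Lemma pairwise_lt_last p s y :
  pairwise lt s -> y \in s -> y = last p s \/ lt y (last p s).
Proof.
elim/last_ind: s => // s z _; rewrite pairwise_rcons last_rcons mem_rcons inE.
by case/andP=> /allP ltz _ /predU1P[|/ltz]; [left | right].
Qed.

Lemma pairwise_index_ltn s x y : pairwise lt s -> x \in s -> y \in s ->
  (index x s < index y s) = lt x y.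
Proof.
move=> Ps xs ys; have ss : sorted lt s by rewrite sorted_pairwise.
apply/idP/idP => [|xy]; first exact: (sorted_ltn_index lt_trans ss).
rewrite ltnNge leq_eqVlt; apply/negP => /predU1P[eq_index | lt_index].
  by move: xy; rewrite -(nth_index x xs) -eq_index nth_index ?lt_irr.
have yx := sorted_ltn_index lt_trans ss y x ys xs lt_index.
by move: (lt_trans xy yx); rewrite lt_irr.
Qed.

Lemma pairwise_take_index s u : pairwise lt s ->
  u \in s \/ {in s, forall x, lt x u} ->
  take (index u s) s = [seq x <- s | lt x u].
Proof.
move=> Ps u_s; have Us := pairwise_uniq lt_irr Ps.
rewrite (subseq_uniqP Us (take_subseq s (index u s))).
apply: eq_in_filter => x xs; rewrite /= in_take_leq ?index_size //.
case: u_s => [us | s_u]; first exact: pairwise_index_ltn.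
have u_notin : u \notin s by apply/negP => /s_u; rewrite lt_irr.
by rewrite (memNindex u_notin) index_mem xs s_u.
Qed.

Lemma scan_left_max cut p s y : pairwise lt s -> y \in s ->
  (cut (scan_left cut p s) p -> cut y p) ->
  y = scan_left cut p s \/ lt y (scan_left cut p s).
Proof.
move=> Ps ys; case: scan_leftP => [below | _ _]; last exact: pairwise_lt_last.
have := below; rewrite has_filter => /(last_in p).
rewrite mem_filter => /andP[-> _] /(_ isT) yp; apply: pairwise_lt_last.
  exact: pairwise_filter.
by rewrite mem_filter yp.
Qed.

Lemma greedy_match_right_to_left ps s x y : pairwise lt s ->
  {in ps, forall p, lt x p -> lt y p} -> x \in s -> y \in s -> lt x y ->
  x \in greedy_match lt ps s ->
  index y (greedy_match lt ps s) < index x (greedy_match lt ps s).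
Proof.
elim: ps s => [|p ps IHps] // s Ps no_cut xs ys xy.
have s0 : s != [::] by case: (s) xs.
have Us := pairwise_uniq lt_irr Ps.
rewrite greedy_match_cons //; set q := scan_left _ _ _.
have qx : q != x.
  apply/eqP => qx; case: (@scan_left_max lt p s y Ps ys); rewrite -/q ?qx.
  - by apply: no_cut; rewrite mem_head.
  - by move=> yx; move: xy; rewrite yx lt_irr.
  - by move=> yx; move: (lt_trans xy yx); rewrite lt_irr.
rewrite inE eq_sym (negbTE qx) /= (negbTE qx) => x_tail.
have [// | qy] := eqVneq q y; rewrite ltnS; apply: IHps => //.
- exact: pairwise_rem.
- by move=> p' p'ps; apply: no_cut; rewrite inE p'ps orbT.
- by rewrite mem_rem_uniq // inE eq_sym qx.
- by rewrite mem_rem_uniq // inE eq_sym qy.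
Qed.

Lemma greedy_match_nseq p s : uniq s -> {in s, forall x, lt x p} ->
  greedy_match lt (nseq (size s) p) s = rev s.
Proof.
elim/last_ind: s => // s z IHs; rewrite rcons_uniq => /andP[zs Us] s_p.
rewrite size_rcons rev_rcons greedy_match_cons; last by case: (s).
have -> : scan_left lt p (rcons s z) = z.
  by rewrite /scan_left (all_filterP _) ?last_rcons //; apply/allP.
have -> : rem z (rcons s z) = s.
  rewrite rem_filter ?rcons_uniq ?zs // filter_rcons /= eqxx /=.
  by apply/all_filterP/allP => x xs /=; apply: contraNneq zs => <-.
by rewrite IHs // => x xs; apply: s_p; rewrite mem_rcons inE xs orbT.
Qed.
End StrictOrder.
End Scan.

(** * Reading order and content order *)

(* Cells are pairs (row, column), counted from 0. *)
Local Notation cell := (nat * nat)%type.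

Definition reading_lt (x y : cell) :=
  (y.1 < x.1) || (x.1 == y.1) && (x.2 < y.2).

Definition content_lt (x y : cell) := x.2 + y.1 < y.2 + x.1.

Lemma reading_lt_irr : irreflexive reading_lt.
Proof. by move=> x; rewrite /reading_lt !ltnn andbF. Qed.

Lemma reading_lt_trans : transitive reading_lt.
Proof. by move=> y x z; rewrite /reading_lt; lia. Qed.

Lemma reading_lt_total x y : x != y -> reading_lt x y || reading_lt y x.
Proof. by case: x y => [a b] [c d]; rewrite xpair_eqE /reading_lt /=; lia. Qed.

Definition blocked (u v : cell) := (v.1 == u.1.+1) && (u.2 < v.2).

Definition right_of (u v : cell) := (v.1 == u.1) && (u.2 < v.2).

(* In a semistandard tableau these hold between the cells [ps] of a letter and
   the cells [s] of the next letter. *)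
Definition consecutive_layers (ps s : seq cell) :=
  {in ps & s, forall u v, (v.1 <= u.1 -> u.2 < v.2) /\
                          (u.1 < v.1 -> u.2 < v.2 -> v.1 = u.1.+1)}.

Definition blocked_exhausted (ps s : seq cell) := forall ps1 u ps2,
  ps = ps1 ++ u :: ps2 -> count (blocked u) s <= count (right_of u) ps1.

Lemma reading_lt_content_lt u v : ~~ blocked u v ->
  (v.1 <= u.1 -> u.2 < v.2) -> (u.1 < v.1 -> u.2 < v.2 -> v.1 = u.1.+1) ->
  reading_lt v u = content_lt v u /\ reading_lt u v = content_lt u v.
Proof.
case: u v => [a b] [c d]; rewrite /blocked /reading_lt /content_lt /=.
by move=> not_blocked left_below next_row; split; apply/idP/idP; lia.
Qed.

Lemma blocked_between w u v q :
  right_of w u -> blocked w v -> reading_lt v q -> reading_lt q u ->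
  (q.1 <= u.1 -> u.2 < q.2) -> blocked w q.
Proof. by rewrite /right_of /blocked /reading_lt; lia. Qed.

Lemma blocked_exhausted_scan u ps s (q := scan_left reading_lt u s) :
  pairwise reading_lt s -> s != [::] -> consecutive_layers (u :: ps) s ->
  blocked_exhausted (u :: ps) s -> blocked_exhausted ps (rem q s).
Proof.
move=> Ps s0 layers exhausted ps1 w ps2 Eps.
have := exhausted (u :: ps1) w ps2; rewrite /= Eps => /(_ erefl).
have qs : q \in s := scan_left_mem _ _ s0.
rewrite count_rem qs /=; case rw: (right_of w u) => /=; last by lia.
have [/hasP[v vs wv] | ] := boolP (has (blocked w) s); last first.
  by rewrite has_count; lia.
suff -> : blocked w q by lia.
have vu : reading_lt v u.
  by move: wv rw; rewrite /blocked /right_of /reading_lt; lia.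
have qu : reading_lt q u by apply: scan_left_cut vu.
have [qE | vq] := scan_left_max Ps vs (fun=> vu); first by rewrite /q -qE.
apply: blocked_between rw wv vq qu _.
by case: (layers u q _ qs); rewrite ?mem_head.
Qed.

(* The cells which separate the two orders are the blocked ones, and these are
   used up by the cells to the right of [u] before the scan from [u] starts. *)
Lemma greedy_match_reading_content ps s :
  pairwise reading_lt s -> consecutive_layers ps s -> blocked_exhausted ps s ->
  greedy_match reading_lt ps s = greedy_match content_lt ps s /\
  (forall x0 r, r < size (greedy_match reading_lt ps s) ->
     reading_lt (nth x0 ps r) (nth x0 (greedy_match reading_lt ps s) r) =
     content_lt (nth x0 ps r) (nth x0 (greedy_match reading_lt ps s) r)).
Proof.
elim: ps s => [|u ps IHps] s // Ps layers exhausted.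
have [-> // | s0] := eqVneq s [::].
have same v : v \in s ->
    reading_lt v u = content_lt v u /\ reading_lt u v = content_lt u v.
  move=> vs; have [left_below next_row] := layers u v (mem_head _ _) vs.
  apply: reading_lt_content_lt => //; apply: contraTN isT => uv.
  have := exhausted [::] u ps erefl.
  by rewrite leqNgt -has_count => /hasPn/(_ v vs); rewrite uv.
have qs := scan_left_mem reading_lt u s0.
have qE : scan_left content_lt u s = scan_left reading_lt u s.
  by apply: eq_scan_left => v /same[].
rewrite !greedy_match_cons // qE; set q := scan_left reading_lt u s in qs qE *.
have [|||tailE agree] := IHps (rem q s).
- exact: pairwise_rem.
- by move=> w v wps /mem_rem vs; apply: layers; rewrite // inE wps orbT.
- exact: blocked_exhausted_scan.
rewrite tailE; split=> // x0 [|r] /=; first by rewrite (same _ qs).2.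
by rewrite ltnS -tailE => /agree.
Qed.

(** * Charge along a sequence *)

Definition rel_charge (T : Type) (x0 : T) (lt : rel T) (ms : seq T) : nat :=
  \sum_(i < size ms) \sum_(t < i) lt (nth x0 ms t) (nth x0 ms t.+1).

Lemma eq_rel_charge (T T' : Type) (x0 : T) (y0 : T') lt lt' ms ms' :
  size ms = size ms' ->
  (forall t, t.+1 < size ms -> lt (nth x0 ms t) (nth x0 ms t.+1) =
                               lt' (nth y0 ms' t) (nth y0 ms' t.+1)) ->
  rel_charge x0 lt ms = rel_charge y0 lt' ms'.
Proof.
move=> eq_size eq_lt; rewrite /rel_charge -eq_size; apply: eq_bigr => i _.
apply: eq_bigr => t _; rewrite eq_lt //.
by apply: leq_ltn_trans (ltn_ord i); apply: ltn_ord.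
Qed.

Lemma sumn_map_iota m n (F : nat -> nat) :
  sumn [seq F t | t <- iota m n] = \sum_(t < n) F (m + t).
Proof.
rewrite -[m]addn0 iotaDl -map_comp sumnE big_map addn0 -[n in iota _ n]subn0.
by rewrite -/(index_iota 0 n) big_mkord.
Qed.

Lemma perm_charge_rel w : perm_charge w =
  rel_charge 0 (fun a b => index a w < index b w) (iota 1 (size w)).
Proof.
rewrite /perm_charge sumn_map_iota /rel_charge size_iota.
apply: eq_bigr => i _; rewrite sumn_map_iota; apply: eq_bigr => t _.
rewrite !nth_iota ?add1n //; last exact: ltn_trans (ltn_ord t) (ltn_ord i).
exact: leq_ltn_trans (ltn_ord t) (ltn_ord i).
Qed.

(** * Charge of reading words *)

Lemma foldr_maxn_mem (s : seq nat) : s != [::] -> foldr maxn 0 s \in s.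
Proof.
elim: s => // a s IHs _ /=; rewrite inE; have [-> | s0] := eqVneq s [::].
  by rewrite maxn0 eqxx.
by case: (leqP a (foldr maxn 0 s)) => _; rewrite ?eqxx // IHs ?orbT.
Qed.

Lemma leq_foldr_maxn (s : seq nat) x : x \in s -> x <= foldr maxn 0 s.
Proof. by rewrite foldrE => xs; apply: (leq_bigmax_seq (F := id)). Qed.

Section InsertAfter.
Variables (w : seq nat) (p x : nat).
Hypotheses (pw : p \in w) (xw : x \notin w).

Lemma perm_insert_after : perm_eq (insert_after w p x) (x :: w).
Proof.
by rewrite /insert_after perm_catC /= perm_cons perm_catC cat_take_drop.
Qed.

Lemma index_insert_after z : z \in w ->
  index z (insert_after w p x) = index z w + (index p w < index z w).
Proof.
move=> zw; rewrite /insert_after; set u := take _ _; set v := drop _ _.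
have xz : x != z by apply: contraNneq xw => ->.
have size_u : size u = (index p w).+1 by rewrite size_takel // index_mem.
have -> : index z w = index z (u ++ v) by rewrite cat_take_drop.
rewrite !index_cat /= (negbTE xz) size_u; case zu: (z \in u); last lia.
by have := zu; rewrite -index_mem size_u; lia.
Qed.

Lemma index_insert_after_new :
  index x (insert_after w p x) = (index p w).+1.
Proof.
rewrite /insert_after index_cat ifN /= ?eqxx ?addn0 ?size_takel ?index_mem //.
by apply: contra xw => /mem_take.
Qed.
End InsertAfter.

Section ReadingPerm.
Variable cs : seq nat.
Local Notation c i := (nth 0 cs i.-1).

Definition lower_letters i := [seq j <- iota 1 i.-1 | c j < c i].

Definition parent i := last 0 [seq j <- lower_letters i |
  c j == foldr maxn 0 [seq c j | j <- lower_letters i]].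

Definition reading_step (w : seq nat) i :=
  if lower_letters i is [::] then i :: w else insert_after w (parent i) i.

Definition partial_reading n := foldl reading_step [:: 1] (iota 2 n).

Lemma reading_permE :
  cs != [::] -> reading_perm cs = partial_reading (size cs).-1.
Proof.
rewrite /reading_perm /partial_reading /reading_step /parent /lower_letters.
by case: cs.
Qed.

Lemma partial_readingS n :
  partial_reading n.+1 = reading_step (partial_reading n) n.+2.
Proof. by rewrite /partial_reading -[in LHS](addn1 n) iotaD foldl_cat. Qed.

Lemma mem_lower_letters i j :
  (j \in lower_letters i) = (0 < j < i) && (c j < c i).
Proof. by rewrite mem_filter mem_iota andbC; case: i => //=; lia. Qed.

Lemma parentP i (p := parent i) : lower_letters i != [::] ->
  [/\ 0 < p < i, c p < c i &
      forall j, 0 < j < i -> c j < c i -> c j <= c p /\ (c j = c p -> j <= p)].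
Proof.
move=> low0; set best := foldr maxn 0 [seq c j | j <- lower_letters i].
have [j0 j0_low bestE] : exists2 j, j \in lower_letters i & best = c j.
  by apply/mapP/foldr_maxn_mem; case: (lower_letters i) low0.
set s := [seq j <- lower_letters i | c j == best].
have s0 : s != [::].
  by rewrite -has_filter; apply/hasP; exists j0; rewrite ?bestE.
have := last_in 0 s0; rewrite mem_filter mem_lower_letters -/p.
case/and3P=> /eqP cp pi cpi; split=> // j ji cji.
have j_low : j \in lower_letters i by rewrite mem_lower_letters ji.
split=> [|cjp].
  by rewrite cp; apply: leq_foldr_maxn; apply/mapP; exists j.
have js : j \in s by rewrite mem_filter cjp cp eqxx.
have : sorted ltn s.
  rewrite /s /lower_letters.
  by do 2 apply: (sorted_filter ltn_trans); apply: iota_ltn_sorted.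
rewrite (sorted_pairwise ltn_trans) => Ps.
by case: (pairwise_lt_last 0 Ps js) => [-> // | /ltnW].
Qed.

(* The reading word is a preorder traversal of the tree of parents.  These are
   pairs whose order is forced without knowing the tree; they include all pairs
   of consecutive letters. *)
Definition precedes i j : Prop :=
  (j < i /\ c i <= c j) \/
  [/\ i < j, c i < c j & forall t, i < t < j -> c t != c i].

Section ReadingStep.
Variables (w : seq nat) (x : nat).
Hypothesis mem_w : forall z, (z \in w) = (0 < z < x).
Hypothesis w_precedes :
  {in w &, forall i j, precedes i j -> index i w < index j w}.

Let x_notin : x \notin w. Proof. by rewrite mem_w ltnn andbF. Qed.

Lemma precedes_leq_parent i : lower_letters x != [::] -> i \in w ->
  precedes i x -> index i w <= index (parent x) w.
Proof.
move=> low0; have [px cpx p_max] := parentP low0.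
set p := parent x in px cpx p_max *.
have pw : p \in w by rewrite mem_w.
move=> iw; have := iw; rewrite mem_w => ix [[] | [_ cix i_last]]; first lia.
have [cip ip] := p_max i ix cix; case: (ltngtP i p) => [lt_ip | lt_pi | -> //].
  apply/ltnW/w_precedes => //; right; split=> // [|t tp].
    by rewrite ltn_neqAle cip eq_sym i_last; lia.
  by apply: i_last; lia.
by apply/ltnW/w_precedes => //; left.
Qed.

Lemma parent_ltn_precedes j : lower_letters x != [::] -> j \in w ->
  precedes x j -> index (parent x) w < index j w.
Proof.
move=> low0; have [px cpx p_max] := parentP low0.
set p := parent x in px cpx p_max *.
have pw : p \in w by rewrite mem_w.
move=> jw; have := jw; rewrite mem_w => jx [[_ cxj] | []]; last lia.
have cpj := leq_trans cpx cxj; apply: w_precedes => //.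
case: (ltngtP j p) => [lt_jp | lt_pj | jp].
  by left; split=> //; apply: ltnW.
  right; split=> // t /andP[pt tj]; apply/eqP => ctp.
  by have [||_ /(_ ctp)] := p_max t; lia.
by move: cpj; rewrite jp ltnn.
Qed.

Lemma perm_reading_step : perm_eq (reading_step w x) (x :: w).
Proof.
rewrite /reading_step; case: (lower_letters x) => // *.
exact: perm_insert_after.
Qed.

Lemma reading_step_precedes : {in reading_step w x &, forall i j,
  precedes i j -> index i (reading_step w x) < index j (reading_step w x)}.
Proof.
have old z : z \in w -> x == z = false.
  by move=> zw; apply: contraNF x_notin => /eqP->.
move=> i j; rewrite !(perm_mem perm_reading_step) !inE /reading_step.
have [low_nil | low0] := eqVneq (lower_letters x) [::].
  rewrite low_nil /=; case/predU1P=> [-> | iw]; case/predU1P=> [-> | jw] ij.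
  - by case: ij => -[]; rewrite ltnn.
  - by rewrite eqxx old.
  - case: ij => [[] | [ix cix _]]; first by rewrite mem_w in iw; lia.
    suff : i \in lower_letters x by rewrite low_nil.
    by rewrite mem_lower_letters cix -mem_w iw.
  by rewrite !old //= ltnS w_precedes.
have [px _ _] := parentP low0; have pw : parent x \in w by rewrite mem_w.
have -> : (if lower_letters x is [::] then x :: w
           else insert_after w (parent x) x) = insert_after w (parent x) x.
  by case: (lower_letters x) low0.
case/predU1P=> [-> | iw]; case/predU1P=> [-> | jw] ij.
- by case: ij => -[]; rewrite ltnn.
- rewrite index_insert_after_new // index_insert_after //.
  by have := parent_ltn_precedes low0 jw ij; lia.
- rewrite index_insert_after_new // index_insert_after //.
  by have := precedes_leq_parent low0 iw ij; lia.
by rewrite !index_insert_after //; have := w_precedes iw jw ij; lia.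
Qed.
End ReadingStep.

Lemma partial_readingP n (w := partial_reading n) :
  perm_eq w (iota 1 n.+1) /\
  {in w &, forall i j, precedes i j -> index i w < index j w}.
Proof.
rewrite {}/w; elim: n => [|n [perm_w w_precedes]].
  by split=> // i j; rewrite !inE => /eqP-> /eqP-> [[]|[]].
have mem_w z : (z \in partial_reading n) = (0 < z < n.+2).
  by rewrite (perm_mem perm_w) mem_iota.
rewrite partial_readingS; split; last exact: reading_step_precedes.
rewrite (permPl (perm_reading_step _ _)) -[in iota _ _](addn1 n.+1) iotaD cats1.
by rewrite perm_sym perm_rcons perm_cons perm_sym.
Qed.
End ReadingPerm.

Lemma perm_charge_reading cs :
  perm_charge (reading_perm cs) = rel_charge 0 ltn cs.
Proof.
have [-> | cs0] := eqVneq cs [::]; first by rewrite /rel_charge big_ord0.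
have size_cs : 0 < size cs by rewrite lt0n size_eq0.
have [perm_w w_precedes] := partial_readingP cs (size cs).-1.
rewrite reading_permE // perm_charge_rel; apply: eq_rel_charge.
  by rewrite size_iota (perm_size perm_w) size_iota prednK.
rewrite size_iota (perm_size perm_w) size_iota prednK // => t tn.
rewrite !nth_iota ?(ltnW tn) // !add1n.
have [tw tSw] : t.+1 \in partial_reading cs (size cs).-1 /\
                t.+2 \in partial_reading cs (size cs).-1.
  by rewrite !(perm_mem perm_w) !mem_iota; lia.
rewrite [RHS]/=; case: (ltnP (nth 0 cs t)) => [lt_c | le_c].
  by rewrite w_precedes //; right; split=> // s; lia.
by apply/negbTE; rewrite -leqNgt ltnW // w_precedes //; left.
Qed.

(** * Charge as a sum over rounds of scanning *)

Section Rounds.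
Variables (T : eqType) (cut : rel T) (p0 : T).
Implicit Types (L : nat -> seq T) (M : nat -> seq T).

(* The cells of letter [a], in the order of the charge subwords (or of the sets
   E^r) which contain them; [p0] is a fictitious starting point. *)
Fixpoint layer_match L a : seq T :=
  if a is a'.+1 then greedy_match cut (layer_match L a') (L a)
  else nseq (size (L 1)) p0.

Fixpoint first_picks L a : T :=
  if a is a'.+1 then scan_left cut (first_picks L a') (L a) else p0.

Definition round M n r := [seq nth p0 (M a) r | a <- iota 1 n].

Lemma eq_layer_match L L' : L =1 L' -> layer_match L =1 layer_match L'.
Proof. by move=> eqL; elim=> [|a IHa] /=; rewrite ?IHa eqL. Qed.

Lemma layer_match_first L a : L 1 != [::] ->
  (forall b, 0 < b <= a -> L b != [::]) ->
  layer_match L a =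
  first_picks L a :: layer_match (fun b => rem (first_picks L b) (L b)) a.
Proof.
move=> L1; elim: a => [_ | a IHa neL] /=.
  by rewrite size_rem ?scan_left_mem //; case: (L 1) L1.
rewrite IHa => [|b /andP[b0 ba]]; last by rewrite neL // b0 leqW.
by rewrite greedy_match_cons // neL /=.
Qed.
End Rounds.

Definition remove_column (mu : seq nat) := [seq x.-1 | x <- mu & 1 < x].

Lemma part_remove_column mu i :
  is_partition mu -> part (remove_column mu) i = (part mu i).-1.
Proof.
elim: mu i => [|a mu IHmu] i Pamu; first by rewrite part_nil.
have Pmu := is_partition_behead Pamu.
have le_a i' : part (a :: mu) i' <= a := @leq_part _ 0 i' Pamu isT.
rewrite /remove_column /=; case: ltnP => a1.
  by case: i => [|i] //; apply: IHmu.
rewrite -/(remove_column mu); transitivity 0; last by have := le_a i; lia.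
by rewrite IHmu //; have := le_a i.+1; rewrite part_consS; lia.
Qed.

Lemma is_partition_remove_column mu :
  is_partition mu -> is_partition (remove_column mu).
Proof.
move=> Pmu; apply: is_partitionI => [i | i].
  by rewrite !part_remove_column //; have := leq_partS i Pmu; lia.
have /allP/(_ (part (remove_column mu) i)) : all (leq 1) (remove_column mu).
  by rewrite all_map all_filter; apply/allP => -[|[]].
by move=> pos il; apply/pos/mem_nth.
Qed.

Lemma conj_part_remove_column mu j :
  conj_part (remove_column mu) j = conj_part mu j.+1.
Proof.
by rewrite /conj_part count_map count_filter; apply: eq_count => x /=; lia.
Qed.

Section WordCharge.
Variables (T : eqType) (lt : rel T) (ell : T -> nat) (p0 : T).
Hypotheses (lt_irr : irreflexive lt) (lt_trans : transitive lt).

Definition layer (S : seq T) a := [seq x <- S | ell x == a].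

Lemma map_nth_cyc_order (S : seq T) n :
  [seq nth p0 S q | q <- cyc_order (size S) n] =
  rev (take n S) ++ rev (drop n S).
Proof.
have nthS : [seq nth p0 S q | q <- iota 0 (size S)] = S := mkseq_nth p0 S.
by rewrite /cyc_order map_cat !map_rev map_take map_drop nthS.
Qed.

Lemma scan_left_filter_head (P : pred T) (S : seq T) u (i := index u S) :
  pairwise lt S -> u \in S \/ {in S, forall x, lt x u} ->
  scan_left lt u (filter P S) =
  head u (filter P (rev (take i S) ++ rev (drop i S))).
Proof.
move=> PS u_S; rewrite /scan_left filter_cat !filter_rev.
have -> : [seq q <- filter P S | lt q u] = filter P (take i S).
  rewrite (pairwise_take_index lt_irr lt_trans) // -!filter_predI.
  by apply: eq_filter => x /=; rewrite andbC.
rewrite -{1}[S](cat_take_drop i) filter_cat.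
case/lastP: (filter P (take i S)) => [|s z]; last first.
  by rewrite last_rcons rev_rcons.
by case/lastP: (filter P (drop i S)) => // s z; rewrite /= last_rcons rev_rcons.
Qed.

Lemma mark_scan (S : seq T) u a : pairwise lt S ->
  u \in S \/ {in S, forall x, lt x u} -> layer S a != [::] ->
  nth 0 [seq q <- cyc_order (size (map ell S)) (index u S) |
         nth 0 (map ell S) q == a] 0 = index (scan_left lt u (layer S a)) S.
Proof.
move=> PS u_S La; rewrite size_map /layer scan_left_filter_head //.
rewrite -map_nth_cyc_order filter_map; set marked := filter _ (cyc_order _ _).
have mem_cyc q : q \in cyc_order (size S) (index u S) -> q < size S.
  by rewrite mem_cat !mem_rev => /orP[/mem_take | /mem_drop]; rewrite mem_iota.
have marksE :
    marked = [seq q <- cyc_order (size S) (index u S) | ell (nth p0 S q) == a].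
  by apply: eq_in_filter => q /mem_cyc qS; rewrite (nth_map p0).
rewrite -[filter (preim _ _) _]marksE.
have: {subset marked <= gtn (size S)}.
  by move=> q; rewrite mem_filter => /andP[_ /mem_cyc].
have : marked != [::].
  apply: contraNneq La => marked_nil; have := map_nth_cyc_order S (index u S).
  move/(congr1 (count (fun x => ell x == a))); rewrite count_map.
  rewrite count_cat !count_rev -count_cat cat_take_drop => countE.
  rewrite -size_eq0 size_filter -countE -size_filter.
  by rewrite -[filter _ _]marksE marked_nil.
case: marked {marksE} => // q marked _ /(_ q (mem_head _ _)) qS /=.
by rewrite index_uniq // (pairwise_uniq lt_irr).
Qed.

Lemma mark_from_picks (S : seq T) (g := first_picks lt p0 (layer S)) n a :
  pairwise lt S -> {in S, forall x, lt x p0} ->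
  (forall b, 0 < b <= a + n -> layer S b != [::]) ->
  mark_from (map ell S) (iota a.+1 n) (index (g a) S) =
  [seq index (g b) S | b <- iota a.+1 n].
Proof.
move=> PS S_p0; elim: n a => // n IHn a neL; rewrite /= mark_scan //.
- rewrite -[scan_left _ _ _]/(g a.+1) IHn // => b b_le.
  by apply: neL; rewrite addnS.
- case: a neL => [|a] neL; [by right | left].
  have a_le : 0 < a.+1 <= a.+1 + n.+1 by rewrite leq_addr.
  by have := scan_left_mem lt (g a) (neL _ a_le); rewrite mem_filter => /andP[].
by apply: neL; lia.
Qed.

(* [S] is the list of positions of a word of content [mu] in the letters
   1, 2, ..., read along [lt]. *)
Definition content_word (mu : seq nat) (S : seq T) : Prop :=
  [/\ pairwise lt S, {in S, forall x, 0 < ell x}, {in S, forall x, lt x p0} &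
      forall a, size (layer S a.+1) = part mu a].

Section FirstRound.
Variables (mu : seq nat) (S : seq T).
Hypotheses (Pmu : is_partition mu) (S_content : content_word mu S).
Local Notation h := (size mu).
Local Notation g := (first_picks lt p0 (layer S)).

Definition first_marked := [seq g b | b <- iota 1 h].
Definition unmarked := [seq x <- S | x \notin first_marked].

Let PS : pairwise lt S. Proof. by case: S_content. Qed.

Lemma layer_neq0 a : 0 < a <= h -> layer S a != [::].
Proof.
case: S_content => _ _ _ sizeL; case: a => // a /andP[_ ah].
by rewrite -size_eq0 sizeL -lt0n part_gt0.
Qed.

Lemma letter_bounds x : x \in S -> 0 < ell x <= h.
Proof.
case: S_content => _ pos _ sizeL xS; have := pos x xS.
case Ex: (ell x) => [//|a] _.
rewrite /= -part_gt0 // -sizeL size_filter -has_count.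
by apply/hasP; exists x; rewrite ?Ex /=.
Qed.

Lemma first_picks_in b : 0 < b <= h -> g b \in S /\ ell (g b) = b.
Proof.
case: b => // b bh; have := scan_left_mem lt (g b) (layer_neq0 bh).
by rewrite mem_filter => /andP[/eqP-> ->].
Qed.

Lemma first_markedP x :
  reflect (exists2 b, 0 < b <= h & x = g b) (x \in first_marked).
Proof.
apply: (iffP mapP) => -[b bh ->]; exists b => //.
  by move: bh; rewrite mem_iota add1n.
by rewrite mem_iota add1n.
Qed.

Lemma first_marked_sub : {subset first_marked <= S}.
Proof. by move=> x /first_markedP[b /first_picks_in[gS _] ->]. Qed.

Lemma mem_first_marked x : x \in S -> (x \in first_marked) = (x == g (ell x)).
Proof.
move=> xS; apply/first_markedP/eqP => [[b /first_picks_in[_ gb] ->] | ->].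
  by rewrite gb.
by exists (ell x); rewrite ?letter_bounds.
Qed.

Lemma foldr_maxn_letters : foldr maxn 0 (map ell S) = h.
Proof.
apply/eqP; rewrite foldrE big_map eqn_leq; apply/andP; split.
  by apply/bigmax_leqP_seq => x /letter_bounds/andP[].
have [-> // | h0] := posnP h.
have [gS gh] := first_picks_in (b := h) (introT andP (conj h0 (leqnn h))).
by rewrite -{1}gh (leq_bigmax_seq (F := ell)).
Qed.

Lemma first_marks_picks :
  first_marks (map ell S) = [seq index x S | x <- first_marked].
Proof.
have [_ _ S_p0 _] := S_content.
have p0_notin : p0 \notin S by apply/negP => /S_p0; rewrite lt_irr.
rewrite /first_marks foldr_maxn_letters size_map -(memNindex p0_notin).
rewrite -map_comp; apply: (mark_from_picks (a := 0)) => // b; exact: layer_neq0.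
Qed.

Lemma subword (P : pred T) :
  [seq nth 0 (map ell S) q | q <- iota 0 (size S) & P (nth p0 S q)] =
  map ell (filter P S).
Proof.
rewrite -[S in RHS](mkseq_nth p0) filter_map -map_comp.
apply/eq_in_map => q; rewrite mem_filter mem_iota => /andP[_ qS] /=.
by rewrite (nth_map p0).
Qed.

Lemma mem_first_marks q : q < size S ->
  (q \in first_marks (map ell S)) = (nth p0 S q \in first_marked).
Proof.
move=> qS; rewrite first_marks_picks; apply/mapP/idP => [[x x_m ->] | q_m].
  by rewrite nth_index // first_marked_sub.
by exists (nth p0 S q); rewrite ?index_uniq // (pairwise_uniq lt_irr).
Qed.

Lemma word_charge_fuelS f : S != [::] ->
  word_charge_fuel f.+1 (map ell S) =
  perm_charge (map ell [seq x <- S | x \in first_marked]) +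
  word_charge_fuel f (map ell unmarked).
Proof.
rewrite -size_eq0 -(size_map ell) size_eq0 /unmarked -!subword => w0.
have -> : forall w, w != [::] -> word_charge_fuel f.+1 w =
    perm_charge [seq nth 0 w q | q <- iota 0 (size w) & q \in first_marks w] +
    word_charge_fuel f
      [seq nth 0 w q | q <- iota 0 (size w) & q \notin first_marks w].
  by case.
  rewrite size_map; congr (perm_charge _ + word_charge_fuel f _).
    congr map; apply: eq_in_filter => q; rewrite mem_iota => /andP[_ qS].
    exact: mem_first_marks.
  congr map; apply: eq_in_filter => q; rewrite mem_iota => /andP[_ qS].
  by rewrite mem_first_marks.
exact: w0.
Qed.

Lemma perm_charge_first_marked :
  perm_charge (map ell [seq x <- S | x \in first_marked]) =
  rel_charge p0 lt first_marked.
Proof.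
set K := filter _ S; have PK : pairwise lt K by apply: pairwise_filter.
have mem_K x : (x \in K) = (x \in first_marked).
  by rewrite mem_filter andb_idr //; apply: first_marked_sub.
have uniq_marked : uniq first_marked.
  rewrite map_inj_in_uniq ?iota_uniq // => b b'.
  rewrite !mem_iota !add1n => bh b'h /(congr1 ell).
  by rewrite (first_picks_in bh).2 (first_picks_in b'h).2.
have size_K : size K = h.
  rewrite -(size_iota 1 h) -(size_map g); apply/perm_size/uniq_perm => //.
  exact: pairwise_uniq PK.
have index_K b : 0 < b <= h -> index b (map ell K) = index (g b) K.
  move=> bh; rewrite /index find_map; apply: eq_in_find => x.
  rewrite mem_K => /first_markedP[b' b'h ->] /=.
  apply/eqP/eqP => [<- | ->]; last exact: (first_picks_in bh).2.
  by rewrite (first_picks_in b'h).2.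
rewrite perm_charge_rel; apply: eq_rel_charge => [|t].
  by rewrite !size_map !size_iota size_K.
rewrite size_iota size_map size_K => th.
have th' : t < h := ltnW th.
rewrite !(nth_map 0) ?size_iota // !nth_iota // !add1n !index_K //.
rewrite (pairwise_index_ltn lt_irr lt_trans) // mem_K map_f // mem_iota; lia.
Qed.

Lemma layer_unmarked a : layer unmarked a = rem (g a) (layer S a).
Proof.
rewrite rem_filter; last exact/filter_uniq/(pairwise_uniq lt_irr).
rewrite /layer /unmarked -!filter_predI; apply: eq_in_filter => x xS /=.
by rewrite mem_first_marked //; case: eqP => [-> | _]; rewrite ?andbF ?andbT.
Qed.

Lemma unmarked_content : content_word (remove_column mu) unmarked.
Proof.
have [_ pos S_p0 sizeL] := S_content.
split; first exact: pairwise_filter.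
- by move=> x; rewrite mem_filter => /andP[_ /pos].
- by move=> x; rewrite mem_filter => /andP[_ /S_p0].
move=> a; rewrite part_remove_column // -sizeL layer_unmarked.
have [-> // | La] := eqVneq (layer S a.+1) [::].
by rewrite size_rem ?scan_left_mem.
Qed.

Lemma size_unmarked : 0 < h -> size unmarked < size S.
Proof.
move=> h0; rewrite size_filter -(count_predC (mem first_marked)) -add1n.
rewrite leq_add2r -has_count; have [gS _] := first_picks_in (b := 1) h0.
by apply/hasP; exists (g 1) => //; apply/first_markedP; exists 1.
Qed.

Lemma layer_match_unmarked a : 0 < h -> a <= h ->
  layer_match lt p0 (layer S) a = g a :: layer_match lt p0 (layer unmarked) a.
Proof.
move=> h0 ah; rewrite layer_match_first ?layer_neq0 // => [|b /andP[b0 ba]].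
  by congr cons; apply: eq_layer_match => b; rewrite layer_unmarked.
by rewrite layer_neq0 // b0 (leq_trans ba).
Qed.

Lemma first_round : 0 < h ->
  round p0 (layer_match lt p0 (layer S)) h 0 = first_marked.
Proof.
move=> h0; apply/eq_in_map => a; rewrite mem_iota add1n ltnS => /andP[_ ah].
by rewrite layer_match_unmarked.
Qed.

Lemma next_round n r : 0 < h -> n <= h ->
  round p0 (layer_match lt p0 (layer S)) n r.+1 =
  round p0 (layer_match lt p0 (layer unmarked)) n r.
Proof.
move=> h0 nh; apply/eq_in_map => a; rewrite mem_iota add1n ltnS => /andP[_ an].
by rewrite layer_match_unmarked // (leq_trans an).
Qed.
End FirstRound.

Lemma word_charge_rounds f mu S :
  is_partition mu -> content_word mu S -> size S <= f ->
  word_charge_fuel f (map ell S) =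
  \sum_(r < part mu 0)
    rel_charge p0 lt
      (round p0 (layer_match lt p0 (layer S)) (conj_part mu r) r).
Proof.
elim: f mu S => [|f IHf] mu S Pmu S_content le_f.
  have S0 : S = [::] by apply/nilP; rewrite /nilp -leqn0.
  have [_ _ _ /(_ 0) <-] := S_content.
  by rewrite S0 /= big_ord0.
have [S0 | S0] := eqVneq S [::].
  have [_ _ _ /(_ 0) <-] := S_content.
  by rewrite S0 /= big_ord0.
have h0 : 0 < size mu.
  have letters := letter_bounds Pmu S_content.
  case: (S) S0 letters => // x S' _ /(_ x (mem_head _ _)); lia.
have mu0 : 0 < part mu 0 by rewrite part_gt0.
rewrite (word_charge_fuelS Pmu S_content) // (perm_charge_first_marked Pmu) //.
rewrite -(prednK mu0) big_ord_recl conj_part0 // (first_round Pmu) //.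
congr (_ + _); rewrite (IHf _ _ (is_partition_remove_column Pmu)).
- rewrite part_remove_column //; apply: eq_bigr => r _.
  rewrite conj_part_remove_column (next_round Pmu) //.
  exact: conj_part_leq_size.
- exact: unmarked_content.
by rewrite -ltnS (leq_trans (size_unmarked Pmu S_content h0)).
Qed.
End WordCharge.

(** * Towers of partitions and semistandard tableaux *)

Definition tower (mu : seq nat) (A : seq (seq nat)) : Prop :=
  [/\ size A = (size mu).+1, nth [::] A 0 = [::],
      forall i, i <= size mu -> is_partition (nth [::] A i),
      forall i, i < size mu ->
        sumn (nth [::] A i.+1) = sumn (nth [::] A i) + nth 0 mu i &
      forall i, i < size mu -> interlaced (nth [::] A i) (nth [::] A i.+1)].

Lemma sumn_takeS (mu : seq nat) i :
  i < size mu -> sumn (take i.+1 mu) = sumn (take i mu) + nth 0 mu i.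
Proof. by move=> im; rewrite (take_nth 0) // sumn_rcons. Qed.

Lemma sumn_take_leq (mu : seq nat) i : sumn (take i mu) <= sumn mu.
Proof. by rewrite -{2}(cat_take_drop i mu) sumn_cat leq_addr. Qed.

Lemma tower_sumn mu A i :
  tower mu A -> i <= size mu -> sumn (nth [::] A i) = sumn (take i mu).
Proof.
case=> _ A0 _ A_sum _; elim: i => [|i IHi] im; first by rewrite A0 take0.
by rewrite A_sum // sumn_takeS // IHi // ltnW.
Qed.

Lemma tower_sumn_leq mu A i :
  tower mu A -> i <= size mu -> sumn (nth [::] A i) <= sumn mu.
Proof. by move=> tA im; rewrite (tower_sumn tA) ?sumn_take_leq. Qed.

Lemma tower_last_sumn mu A : tower mu A -> sumn (last [::] A) = sumn mu.
Proof.
move=> tA; case: (tA) => sA _ _ _ _.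
by rewrite -nth_last sA (tower_sumn tA) // take_size.
Qed.

Lemma tower_last_partition mu A : tower mu A -> is_partition (last [::] A).
Proof. by case=> sA _ PA _ _; rewrite -nth_last sA; apply: PA. Qed.

Section ABCTower.
Variables (k : nat) (mu : seq nat) (A : seq (seq nat)).
Hypotheses (mu_gt0 : all (leq 1) mu) (muk : sumn mu <= k).

Let mu_pos i : i < size mu -> 0 < nth 0 mu i := all_nthP 0 mu_gt0 i.

Let strip_bound i : i < size mu -> sumn (take i mu) + nth 0 mu i <= k.
Proof.
by move=> im; rewrite -sumn_takeS // (leq_trans (sumn_take_leq _ _)).
Qed.

Lemma is_ABC_tower : is_ABC k mu A -> tower mu A.
Proof.
case=> _ sA A0 _ strips.
have next i : i < size mu -> is_partition (nth [::] A i) ->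
    sumn (nth [::] A i) = sumn (take i mu) ->
    [/\ is_partition (nth [::] A i.+1),
        sumn (nth [::] A i.+1) = sumn (nth [::] A i) + nth 0 mu i &
        interlaced (nth [::] A i) (nth [::] A i.+1)].
  move=> im Pi sum_i; have := strips i.+1 im.
  by rewrite /= bottom_strong_stripP ?mu_pos // sum_i strip_bound.
have rows i : i <= size mu ->
    is_partition (nth [::] A i) /\ sumn (nth [::] A i) = sumn (take i mu).
  elim: i => [|i IHi] im; first by rewrite A0 take0.
  have [Pi sum_i] := IHi (ltnW im); have [PS sumS _] := next i im Pi sum_i.
  by rewrite sumS sum_i sumn_takeS.
split=> // i im; first by case: (rows i im).
  by have [Pi sum_i] := rows i (ltnW im); case: (next i im Pi sum_i).
by have [Pi sum_i] := rows i (ltnW im); case: (next i im Pi sum_i).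
Qed.

Lemma tower_is_ABC : tower mu A -> is_ABC k mu A.
Proof.
move=> tA; have [sA A0 PA A_sum A_il] := tA; split=> //.
- apply/(all_nthP 0) => i im; rewrite mu_pos //=.
  exact: leq_trans (leq_addl _ _) (strip_bound im).
- rewrite sA => i im; apply: is_core_small; first exact: PA.
  exact: leq_trans (tower_sumn_leq tA im) muk.
case=> // i im /=; apply/bottom_strong_stripP; last by split; auto.
- exact/PA/ltnW.
- exact: mu_pos.
by rewrite (tower_sumn tA) ?strip_bound // ltnW.
Qed.
End ABCTower.

Lemma ABC_set_tower n lam mu A : partition_of n mu ->
  ABC_set n lam mu A <-> tower mu A /\ last [::] A = lam.
Proof.
case/andP=> /andP[_ mu_gt0] /eqP mu_n; have mun : sumn mu <= n by rewrite mu_n.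
have small B :
    tower mu B -> is_partition (last [::] B) /\ sumn (last [::] B) <= n.
  by move=> tB; rewrite (tower_last_sumn tB) (tower_last_partition tB).
split=> [[/(is_ABC_tower mu_gt0 mun) tA _] | [tA <-]].
  by have [Plast last_n] := small A tA; rewrite kshape_small.
have [Plast last_n] := small A tA.
by split; [apply: tower_is_ABC | apply: is_core_small | rewrite kshape_small].
Qed.

Lemma count_leqS i (s : seq nat) :
  count (leq^~ i.+1) s = count (leq^~ i) s + count_mem i.+1 s.
Proof. by elim: s => //= x s ->; lia. Qed.

(* [nth [::] A i] is the shape formed by the letters up to [i]. *)
Definition entry (A : seq (seq nat)) s c := find (fun nu => c < part nu s) A.

Definition tableau_of (A : seq (seq nat)) : seq (seq nat) :=
  [seq [seq entry A s c | c <- iota 0 (part (last [::] A) s)]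
  | s <- iota 0 (size (last [::] A))].

Section TowerTableau.
Variables (mu : seq nat) (A : seq (seq nat)).
Hypothesis tA : tower mu A.
Local Notation lam := (last [::] A).
Local Notation row_len i s := (part (nth [::] A i) s).

Let Plam : is_partition lam. Proof. exact: tower_last_partition tA. Qed.

Lemma tower_size : size A = (size mu).+1. Proof. by case: tA. Qed.

Lemma tower_part_last s : row_len (size mu) s = part lam s.
Proof. by rewrite -nth_last tower_size. Qed.

Lemma tower_leq_part i j s : i <= j <= size mu -> row_len i s <= row_len j s.
Proof.
elim: j => [|j IHj]; first by rewrite leqn0 => /andP[/eqP->].
case/andP; rewrite leq_eqVlt => /predU1P[-> // | ij] jm.
have [_ _ _ _ /(_ j jm s)/andP[_ le_j]] := tA.
by apply: leq_trans (IHj _) le_j; rewrite -ltnS ij ltnW.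
Qed.

Lemma leq_entry i s c : i <= size mu -> (entry A s c <= i) = (c < row_len i s).
Proof.
move=> im; apply/idP/idP => [le_i | ci].
  have has_c : has (fun nu => c < part nu s) A.
    by rewrite has_find tower_size ltnS (leq_trans le_i).
  by apply: leq_trans (nth_find [::] has_c) _; rewrite tower_leq_part // le_i.
by rewrite leqNgt; apply/negP => /(before_find [::]); rewrite ci.
Qed.

Lemma entry_eq i s c :
  i < size mu -> (entry A s c == i.+1) = (row_len i s <= c < row_len i.+1 s).
Proof.
move=> im; rewrite eqn_leq leq_entry // andbC ltnNge.
by rewrite leq_entry; [rewrite -leqNgt | apply: ltnW].
Qed.

Lemma entry_bounds s c : c < part lam s -> 0 < entry A s c <= size mu.
Proof.
rewrite -tower_part_last -leq_entry // => ->; rewrite andbT lt0n -leqn0.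
by rewrite leq_entry //; case: tA => _ -> _ _ _; rewrite part_nil.
Qed.

Lemma entry_row s c c' :
  c <= c' -> c' < part lam s -> entry A s c <= entry A s c'.
Proof.
move=> cc' /entry_bounds/andP[_ em]; rewrite leq_entry //.
by apply: leq_ltn_trans cc' _; rewrite -leq_entry.
Qed.

Lemma entry_column s c : c < part lam s.+1 -> entry A s c < entry A s.+1 c.
Proof.
move=> /entry_bounds/andP[]; case eE: (entry A s.+1 c) => [//|e] _ em.
have [_ _ _ _ /(_ e em s)/andP[le_e _]] := tA.
rewrite ltnS leq_entry; last exact: ltnW.
by apply: leq_trans le_e; rewrite -leq_entry // eE.
Qed.

Lemma leq_entry_add s s' c c' : s <= s' -> c <= c' -> c' < part lam s' ->
  entry A s c + (s' - s) <= entry A s' c'.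
Proof.
move=> ss cc' c'l; apply: (@leq_trans (entry A s c' + (s' - s))).
  rewrite leq_add2r; apply: entry_row => //.
  exact: leq_trans c'l (leq_part Plam ss).
elim: s' ss c'l => [|s' IHs']; first by rewrite leqn0 => /eqP->; rewrite addn0.
rewrite leq_eqVlt => /predU1P[-> _ | ss c'l]; first by rewrite subnn addn0.
have := IHs' ss (leq_trans c'l (leq_partS _ Plam)).
by have := entry_column c'l; lia.
Qed.

Lemma size_tableau_of : size (tableau_of A) = size lam.
Proof. by rewrite size_map size_iota. Qed.

Lemma nth_tableau_of s :
  nth [::] (tableau_of A) s = [seq entry A s c | c <- iota 0 (part lam s)].
Proof.
have [sl | ls] := ltnP s (size lam).
  by rewrite (nth_map 0) ?size_iota // nth_iota.
by rewrite /part !nth_default ?size_tableau_of.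
Qed.

Lemma nth_nth_tableau_of s c :
  c < part lam s -> nth 0 (nth [::] (tableau_of A) s) c = entry A s c.
Proof.
by move=> cl; rewrite nth_tableau_of (nth_map 0) ?size_iota // nth_iota.
Qed.

Lemma tower_size_leq i : i <= size mu -> size (nth [::] A i) <= size lam.
Proof.
move=> im; have Pi : is_partition (nth [::] A i) by case: tA => _ _ /(_ i im).
rewrite leqNgt -part_gt0 // -leqNgt.
rewrite (leq_trans (tower_leq_part (j := size mu) _ _)) ?im ?leqnn //.
by rewrite tower_part_last leqNgt part_gt0 // ltnn.
Qed.

Lemma count_tableau_of_leq i : i <= size mu ->
  count (leq^~ i) (flatten (tableau_of A)) = sumn (nth [::] A i).
Proof.
move=> im; rewrite count_flatten -map_comp sumn_map_iota.
rewrite (sumn_part (tower_size_leq im)) big_mkord; apply: eq_bigr => s _ /=.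
rewrite count_map -[RHS]subn0 -(@count_iota_interval 0 _ (part lam s)).
  by apply: eq_count => c /=; rewrite leq_entry.
by rewrite -tower_part_last tower_leq_part // im /=.
Qed.

Lemma tableau_of_weight a :
  count_mem a.+1 (flatten (tableau_of A)) = nth 0 mu a.
Proof.
have [am | ma] := ltnP a (size mu).
  have := count_leqS a (flatten (tableau_of A)).
  rewrite !count_tableau_of_leq //; last exact: ltnW.
  by case: tA => _ _ _ -> // _ /addnI.
rewrite [RHS]nth_default //; apply/count_memPn/flattenP => -[row].
case/mapP=> s _ -> /mapP[c]; rewrite mem_iota => /andP[_ cl] aE.
by have := entry_bounds cl; rewrite -aE; lia.
Qed.

Lemma tableau_of_SSYT : is_SSYT lam mu (tableau_of A).
Proof.
split; first exact: size_tableau_of.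
- by move=> s _; rewrite nth_tableau_of size_map size_iota.
- apply/allP => row /mapP[s _ ->]; apply/andP; split.
    apply/allP => x /mapP[c]; rewrite mem_iota => /andP[_ cl] ->.
    by case/andP: (entry_bounds cl).
  apply/(sortedP 0) => c; rewrite size_map size_iota => cl.
  rewrite !(nth_map 0) ?size_iota ?(ltnW cl) // !nth_iota ?(ltnW cl) //.
  exact: entry_row.
- move=> s c; rewrite nth_tableau_of size_map size_iota => cl.
  rewrite -!nth_tableau_of !nth_nth_tableau_of //; first exact: entry_column.
  exact: leq_trans cl (leq_partS _ Plam).
exact: tableau_of_weight.
Qed.
End TowerTableau.

Lemma eq_ltn m n : (forall c, (c < m) = (c < n)) -> m = n.
Proof. by move=> eq_lt; have := eq_lt m; have := eq_lt n; lia. Qed.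

Lemma tableau_of_inj mu A B :
  tower mu A -> tower mu B -> last [::] A = last [::] B ->
  tableau_of A = tableau_of B -> A = B.
Proof.
move=> tA tB eq_last eq_tab.
apply: (@eq_from_nth _ [::]) => [|i]; rewrite (tower_size tA).
  by rewrite (tower_size tB).
rewrite ltnS => im; have [_ _ PA _ _] := tA; have [_ _ PB _ _] := tB.
apply: eq_from_part => [||s]; [exact: PA | exact: PB | apply: eq_ltn => c].
have [cl | lc] := ltnP c (part (last [::] A) s).
  rewrite -(leq_entry tA) // -(leq_entry tB) // -(nth_nth_tableau_of cl) eq_tab.
  by rewrite nth_nth_tableau_of // -eq_last.
have above C : tower mu C -> last [::] C = last [::] A ->
    (c < part (nth [::] C i) s) = false.
  move=> tC eqC; apply/negbTE; rewrite -leqNgt; apply: leq_trans lc.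
  by rewrite -eqC -(tower_part_last tC) (tower_leq_part tC) // im leqnn.
by rewrite !above.
Qed.

Lemma part_filter_gt0 (l : seq nat) s :
  sorted geq l -> part (filter (leq 1) l) s = nth 0 l s.
Proof.
elim: l s => // a l IHl s sl; have sl' := path_sorted sl.
have le_a i : nth 0 (a :: l) i <= a := sorted_leq_part (j := i) sl (leq0n i).
rewrite /=; case: posnP => a0; last by case: s => //= s; apply: IHl.
by rewrite IHl //; have := le_a s; have := le_a s.+1; case: s => /=; lia.
Qed.

Lemma is_partition_filter_gt0 (l : seq nat) :
  sorted geq l -> is_partition (filter (leq 1) l).
Proof.
move=> sl; rewrite /is_partition filter_all andbT; apply: sorted_filter => //.
by move=> y x z /= xy yz; apply: leq_trans xy.
Qed.

Lemma sumn_filter_gt0 (l : seq nat) : sumn (filter (leq 1) l) = sumn l.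
Proof. by elim: l => //= -[|a] l /= ->. Qed.

Lemma ltn_count_leq (row : seq nat) i c : sorted leq row ->
  (c < count (leq^~ i) row) = (c < size row) && (nth 0 row c <= i).
Proof.
elim: row c => [|x row IHrow] c //= sr.
have {}IHrow := IHrow _ (path_sorted sr).
have [xi | ix] := leqP x i.
  by case: c => //= c; rewrite add1n !ltnS IHrow.
have above y : y \in row -> i < y.
  by move/(allP (order_path_min leq_trans sr)); apply: leq_trans.
rewrite add0n (_ : count _ _ = 0) ?ltn0; last first.
  apply/eqP; rewrite -leqn0 leqNgt -has_count.
  by apply/hasPn => y /above; rewrite -ltnNge.
case: c => [|c] /=; first by rewrite leqNgt ix.
rewrite ltnS; case: ltnP => //= cs; apply/esym/negbTE.
by rewrite -ltnNge above ?mem_nth.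
Qed.

Definition tower_of (mu : seq nat) (T : seq (seq nat)) : seq (seq nat) :=
  mkseq (fun i => filter (leq 1) [seq count (leq^~ i) row | row <- T])
        (size mu).+1.

Section TableauTower.
Variables (lam mu : seq nat) (T : seq (seq nat)).
Hypotheses (Plam : is_partition lam) (ssytT : is_SSYT lam mu T).
Local Notation row_count i s := (count (leq^~ i) (nth [::] T s)).
Local Notation letter s c := (nth 0 (nth [::] T s) c).

Lemma size_row s : size (nth [::] T s) = part lam s.
Proof.
case: ssytT => sizeT sizeR _ _ _.
have [sl | ls] := ltnP s (size lam); first exact: sizeR.
by rewrite /part !nth_default ?sizeT.
Qed.

Lemma row_sorted s : sorted leq (nth [::] T s).
Proof.
case: ssytT => _ _ /allP rows _ _.
have [sT | Ts] := ltnP s (size T); last by rewrite nth_default.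
by case/andP: (rows _ (mem_nth [::] sT)).
Qed.

Lemma ltn_row_count i s c :
  (c < row_count i s) = (c < part lam s) && (letter s c <= i).
Proof. by rewrite ltn_count_leq ?row_sorted // size_row. Qed.

Lemma row_count_leqS i s : row_count i s <= row_count i.+1 s.
Proof. by rewrite count_leqS leq_addr. Qed.

Lemma row_count_next i s : row_count i.+1 s.+1 <= row_count i s.
Proof.
rewrite leqNgt; apply/negP; rewrite ltn_row_count => /andP[cl le_i].
suff: row_count i s < row_count i s by rewrite ltnn.
rewrite ltn_row_count (leq_trans cl (leq_partS _ Plam)) /=.
have [_ _ _ columns _] := ssytT.
by have := columns s (row_count i s); rewrite size_row => /(_ cl); lia.
Qed.

Lemma nth_row_counts i s :
  nth 0 [seq count (leq^~ i) row | row <- T] s = row_count i s.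
Proof.
have [sT | Ts] := ltnP s (size T); first by rewrite (nth_map [::]).
by rewrite !nth_default ?size_map.
Qed.

Lemma row_counts_sorted i : sorted geq [seq count (leq^~ i) row | row <- T].
Proof.
apply/(sortedP 0) => s _; rewrite !nth_row_counts /=.
exact: leq_trans (row_count_leqS _ _) (row_count_next _ _).
Qed.

Lemma part_tower_of i s :
  i <= size mu -> part (nth [::] (tower_of mu T) i) s = row_count i s.
Proof.
move=> im; rewrite nth_mkseq // part_filter_gt0 ?nth_row_counts //.
exact: row_counts_sorted.
Qed.

Lemma letter_bounds_SSYT s c : c < part lam s -> 0 < letter s c <= size mu.
Proof.
move=> cl; have [sizeT _ /allP rows _ weight] := ssytT.
have rowT : nth [::] T s \in T by rewrite mem_nth // sizeT -part_gt0 //; lia.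
have x_row : letter s c \in nth [::] T s by rewrite mem_nth // size_row.
have x_pos : 0 < letter s c.
  by have /andP[/allP pos _] := rows _ rowT; apply: pos.
rewrite x_pos leqNgt; apply/negP => mu_x.
have : letter s c \in flatten T by apply/flattenP; exists (nth [::] T s).
rewrite -has_pred1 has_count -(prednK x_pos) weight nth_default //.
by rewrite -ltnS prednK.
Qed.

Lemma tower_of_tower : tower mu (tower_of mu T).
Proof.
have [_ _ _ _ weight] := ssytT.
have Prow i : i <= size mu -> is_partition (nth [::] (tower_of mu T) i).
  by move=> im; rewrite nth_mkseq // is_partition_filter_gt0 ?row_counts_sorted.
split=> //; first by rewrite size_mkseq.
- apply: eq_from_part => // [|s]; first exact: Prow.
  rewrite part_tower_of // part_nil; apply/eqP; rewrite -leqn0 leqNgt.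
  by rewrite ltn_row_count; apply/negP => /andP[/letter_bounds_SSYT]; lia.
- move=> i im; rewrite !nth_mkseq //; last exact: leqW.
  by rewrite !sumn_filter_gt0 -!count_flatten count_leqS weight.
move=> i im s; rewrite !part_tower_of //; last exact: ltnW.
by rewrite row_count_next row_count_leqS.
Qed.

Lemma last_tower_of : last [::] (tower_of mu T) = lam.
Proof.
apply: eq_from_part => // [|s].
  exact: tower_last_partition tower_of_tower.
rewrite -(tower_part_last tower_of_tower) part_tower_of //; apply: eq_ltn => c.
rewrite ltn_row_count andb_idr // => /letter_bounds_SSYT.
by case/andP.
Qed.

Lemma tableau_of_tower_of : tableau_of (tower_of mu T) = T.
Proof.
have tA := tower_of_tower; have [sizeT _ _ _ _] := ssytT.
apply: (@eq_from_nth _ [::]) => [|s _].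
  by rewrite size_tableau_of last_tower_of sizeT.
apply: (@eq_from_nth _ 0) => [|c]; rewrite nth_tableau_of size_map size_iota.
  by rewrite last_tower_of size_row.
move=> cl; rewrite -nth_tableau_of nth_nth_tableau_of //.
have e_bounds := entry_bounds tA cl; rewrite last_tower_of in cl.
have x_bounds := letter_bounds_SSYT cl.
have same i :
    i <= size mu -> (entry (tower_of mu T) s c <= i) = (letter s c <= i).
  by move=> im; rewrite (leq_entry tA) // part_tower_of // ltn_row_count cl.
have := same (entry (tower_of mu T) s c); have := same (letter s c); lia.
Qed.
End TableauTower.

(** * Columns of the sets E^r *)

Lemma modvE k c x : x <= c + k -> c <= x + k ->
  modv k c x = if x < c then c - x - 1 else c + k - x.
Proof.
move=> xc cx; rewrite /modv; case: ltnP => [lt_xc | le_cx].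
  have -> : (c%:Z - x%:Z + k%:Z = (c - x - 1)%N%:Z + k.+1%:Z)%R by lia.
  by rewrite modzDr modz_small //; lia.
have -> : (c%:Z - x%:Z + k%:Z = (c + k - x)%N%:Z)%R by lia.
by rewrite modz_small //; lia.
Qed.

Lemma minl_mem s : s != [::] -> minl s \in s.
Proof.
have min_in d t : foldr minn d t \in d :: t.
  elim: t => [|b t]; first exact: mem_head.
  rewrite !inE /=; case: leqP => _; first by rewrite eqxx orbT.
  by case/orP=> ->; rewrite ?orbT.
rewrite /minl; case: s => // a s _; have := min_in a (a :: s).
by rewrite in_cons => /predU1P[-> | //]; apply: mem_head.
Qed.

Lemma minl_leq s x : x \in s -> minl s <= x.
Proof.
rewrite /minl; move: (head 0 s) => d; elim: s => //= a s IHs.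
by rewrite inE geq_min => /predU1P[-> | /IHs->]; rewrite ?leqnn ?orbT.
Qed.

Section Columns.
Variable k : nat.

Definition col (x : cell) : nat := k + 2 + x.2 - x.1.

Definition in_window (P : {pred cell}) : Prop :=
  {in P, forall x, x.1 <= k} /\ {in P &, forall x y, col x <= col y + k}.

Lemma content_lt_window (P : {pred cell}) x y : in_window P ->
  x \in P -> y \in P -> content_lt x y = (col x < col y).
Proof.
case=> rows _ Px Py; have := rows x Px; have := rows y Py.
by rewrite /content_lt /col; lia.
Qed.

Section ColumnScan.
Variables (P : {pred cell}) (p : cell) (s : seq cell).
Hypotheses (window : in_window P) (Pp : p \in P) (sP : {subset s <= P}).
Hypothesis s_reading : pairwise reading_lt s.
Hypothesis s_content : {in s &, forall x y, reading_lt x y -> content_lt x y}.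
Local Notation q := (scan_left content_lt p s).

Lemma modv_window x : x \in P -> modv k (col p) (col x) =
  if col x < col p then col p - col x - 1 else col p + k - col x.
Proof. by case: window => _ cols Px; rewrite modvE // cols. Qed.

Lemma col_inj : {in s &, injective col}.
Proof.
move=> x y xs ys eq_col; apply/eqP; case: eqVneq => // /reading_lt_total.
by case/orP=> /s_content;
  rewrite (content_lt_window window) ?sP // eq_col ltnn; apply.
Qed.

Lemma modv_scan_left v :
  v \in s -> modv k (col p) (col q) <= modv k (col p) (col v).
Proof.
move=> vs; have s0 : s != [::] by case: (s) vs.
have qs := scan_left_mem content_lt p s0.
have [Pq Pv] := (sP qs, sP vs); rewrite !modv_window //.
have v_max : (col q < col p -> col v < col p) -> col v <= col q.
  rewrite -!(content_lt_window window) //.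
  move=> /(scan_left_max s_reading vs)[-> // | vq].
  by apply: ltnW; rewrite -(content_lt_window window) // s_content.
have v_cut : col v < col p -> col q < col p.
  by rewrite -!(content_lt_window window) //; apply: scan_left_cut.
case: window => _ cols.
have := cols _ _ Pq Pv; have := cols _ _ Pv Pq.
have := cols _ _ Pp Pv; have := cols _ _ Pv Pp.
by case: (ltnP (col q) (col p)) v_max v_cut; case: (ltnP (col v) (col p)); lia.
Qed.

Lemma modv_window_inj : {in P &, forall x y,
  modv k (col p) (col x) = modv k (col p) (col y) -> col x = col y}.
Proof.
move=> x y Px Py; rewrite !modv_window //; case: window => _ cols.
have := cols _ _ Px Py; have := cols _ _ Py Px.
have := cols _ _ Px Pp; have := cols _ _ Py Pp.
have := cols _ _ Pp Px; have := cols _ _ Pp Py.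
by case: (ltnP (col x) (col p)); case: (ltnP (col y) (col p)); lia.
Qed.

Lemma mem_closest (pr avail : seq nat) :
  s != [::] -> pr =i [:: col p] -> avail =i map col s ->
  [seq x <- avail |
    has (fun c => modv k c x == minl [seq modv k c y | y <- avail]) pr]
  =i [:: col q].
Proof.
move=> s0 prE availE; have qs := scan_left_mem content_lt p s0.
have minE :
    minl [seq modv k (col p) y | y <- avail] = modv k (col p) (col q).
  apply/eqP; rewrite eqn_leq minl_leq ?map_f ?availE ?map_f //=.
  have /mapP[y] : minl [seq modv k (col p) y | y <- avail] \in
      [seq modv k (col p) y | y <- avail].
    apply: minl_mem; have : col q \in avail by rewrite availE map_f.
    by case: (avail).
  by rewrite availE => /mapP[v vs ->] ->; apply: modv_scan_left.
move=> x; rewrite mem_filter availE inE (eq_has_r prE) /= orbF minE.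
apply/andP/eqP => [[/eqP eq_modv /mapP[v vs xE]] | ->].
  by rewrite xE in eq_modv *; apply: modv_window_inj => //; apply: sP.
by rewrite eqxx map_f.
Qed.
End ColumnScan.

Definition represents (E : seq (seq nat)) (C : seq cell) : Prop :=
  forall r, nth [::] E r =i map col (take 1 (drop r C)).

Lemma represents_cons e E C :
  represents (e :: E) C <-> e =i map col (take 1 C) /\ represents E (behead C).
Proof.
have dropE r : drop r (behead C) = drop r.+1 C.
  by rewrite -drop1 drop_drop addn1.
split=> [rep | [e_first rep] [|r]] /=; last by rewrite -dropE.
  split=> [|r]; first by have := rep 0; rewrite drop0.
  by rewrite dropE; apply: (rep r.+1).
by rewrite drop0.
Qed.

Lemma represents_map (C : seq cell) : represents [seq [:: col x] | x <- C] C.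
Proof.
elim: C => [|x C IHC]; first by case.
by apply/represents_cons; split=> //= y; rewrite take0.
Qed.

Lemma eq_mem_nil (T : eqType) (s : seq T) : s =i [::] -> s = [::].
Proof. by case: s => // a s /(_ a); rewrite mem_head. Qed.

Lemma eq_mem_seq1 (T : eqType) (d : T) (s : seq T) x :
  s =i [:: x] -> s != [::] /\ head d s = x.
Proof.
case: s => [|y s] sE; first by have := sE x; rewrite mem_head.
by split=> //=; have := sE y; rewrite mem_head inE => /esym/eqP.
Qed.

Lemma build_row_empty V E used :
  (forall r, nth [::] E r = [::]) \/ {subset V <= used} ->
  represents (build_row k V E used) [::].
Proof.
elim: E used => [|pr E IHE] used empty; first by case.
have e_nil avail : avail = [seq x <- V | x \notin used] ->
    [seq x <- avail |
      has (fun c => modv k c x == minl [seq modv k c y | y <- avail]) pr]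
    = [::].
  move=> ->; case: empty => [/(_ 0) /= -> | used_all].
    exact: filter_pred0.
  rewrite -filter_predI; apply/eqP; rewrite -[_ == _]negbK -has_filter.
  by apply/hasPn => x /used_all xu /=; rewrite xu andbF.
apply/represents_cons; rewrite e_nil // cats0; split=> //; apply: IHE.
by case: empty => [E_nil | ]; [left=> r; apply: (E_nil r.+1) | right].
Qed.

Lemma build_row_represents (P : {pred cell}) V E used ps s :
  in_window P -> {subset ps <= P} -> {subset s <= P} ->
  pairwise reading_lt s ->
  {in s &, forall x y, reading_lt x y -> content_lt x y} ->
  (forall x, (x \in V) && (x \notin used) = (x \in map col s)) ->
  represents E ps ->
  represents (build_row k V E used) (greedy_match content_lt ps s).
Proof.
move=> window.
elim: E used ps s => [|pr E IHE] used ps s psP sP Ps Cs availE rep.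
  case: ps psP rep => [|p ps] _ rep; first by case.
  by have := rep 0 (col p); rewrite mem_head.
case: ps psP rep => [|p ps] psP rep.
  by apply: build_row_empty; left=> r; apply/eq_mem_nil/(rep r).
have [s_nil | s0] := eqVneq s [::].
  rewrite s_nil greedy_match_nil; apply: build_row_empty; right=> x Vx.
  by have := availE x; rewrite s_nil Vx; case: (x \in used).
have Pp : p \in P by rewrite psP ?mem_head.
have {}psP : {subset ps <= P} by move=> x xps; rewrite psP // inE xps orbT.
have [prE rep_tail] := (represents_cons _ _ _).1 rep.
set q := scan_left content_lt p s; have qs : q \in s by apply: scan_left_mem.
have {}prE : pr =i [:: col p] by move=> x; rewrite prE /= take0.
have freeE : [seq x <- V | x \notin used] =i map col s.
  by move=> x; rewrite mem_filter andbC availE.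
have closest := mem_closest window Pp sP Ps Cs s0 prE freeE.
rewrite greedy_match_cons //; apply/represents_cons; split.
  by move=> x; rewrite closest /= take0.
apply: IHE => //.
- by move=> x /mem_rem; apply: sP.
- exact: pairwise_rem.
- by move=> x y /mem_rem xs /mem_rem ys; apply: Cs.
move=> x; rewrite mem_cat negb_or andbA availE closest inE.
have Us := pairwise_uniq reading_lt_irr Ps.
apply/andP/mapP => [[/mapP[v vs ->] ne] | [v]].
  exists v => //; rewrite mem_rem_uniq // inE vs andbT.
  by apply: contraNneq ne => ->.
rewrite mem_rem_uniq // inE => /andP[vq vs] ->; rewrite map_f //; split=> //.
by apply: contraNneq vq => /(col_inj window sP Cs vs qs) ->.
Qed.
End Columns.

(** * Comparison of the two charges *)

Definition reading_cells (l : seq nat) n : seq cell :=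
  [seq (s, c) | s <- rev (iota 0 n), c <- iota 0 (part l s)].

Lemma mem_reading_cells l n s c :
  ((s, c) \in reading_cells l n) = (s < n) && (c < part l s).
Proof.
apply/allpairsPdep/andP => [[s' [c' [+ + [-> ->]]]] | [sn cl]].
  by rewrite mem_rev !mem_iota.
by exists s, c; rewrite mem_rev !mem_iota.
Qed.

Lemma pairwise_reading_row s n :
  pairwise reading_lt [seq (s, c) | c <- iota 0 n].
Proof.
rewrite pairwise_map; apply: (@sub_pairwise _ ltn) => [c c' cc'|].
  by rewrite /= /reading_lt /= ltnn eqxx.
by rewrite -(sorted_pairwise ltn_trans) iota_ltn_sorted.
Qed.

Lemma pairwise_reading_cells l n : pairwise reading_lt (reading_cells l n).
Proof.
elim: n => // n IHn; rewrite /reading_cells -addn1 iotaD cats1 rev_rcons.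
rewrite allpairs_cons pairwise_cat pairwise_reading_row -/(reading_cells l n).
rewrite IHn !andbT; apply/allrelP => x [s c] /mapP[c' _ ->].
by rewrite mem_reading_cells /reading_lt /= => /andP[->].
Qed.

Lemma find_iota1 (P : pred nat) n h : h <= n ->
  (forall i, i < n -> P i.+1 = (h <= i)) -> find P (iota 1 n) = h.
Proof.
move=> hn PE; rewrite -(subnKC hn) iotaD find_cat size_iota.
have -> : has P (iota 1 h) = false.
  apply/hasPn => -[|i]; rewrite mem_iota // add1n !ltnS => /= ih.
  by rewrite (PE i (leq_trans ih hn)) -ltnNge.
case: (posnP (n - h)) => [-> | hn'] /=; first by rewrite addn0.
by rewrite -(prednK hn') /= add1n PE ?leqnn ?addn0 //; lia.
Qed.

Section Charge.
Variables (k : nat) (mu : seq nat) (A : seq (seq nat)).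
Hypotheses (Pmu : is_partition mu) (muk : sumn mu <= k) (abcA : is_ABC k mu A).
Local Notation lam := (last [::] A).

Let mu_gt0 : all (leq 1) mu. Proof. by case/andP: Pmu. Qed.
Let tA : tower mu A. Proof. exact: is_ABC_tower mu_gt0 muk abcA. Qed.
Let Plam : is_partition lam. Proof. exact: tower_last_partition tA. Qed.

Definition cell_letter (x : cell) := entry A x.1 x.2.
Definition tableau_cells := reading_cells lam (size lam).
Definition scan_start : cell := (0, k.+1).
Definition letter_cells := layer cell_letter tableau_cells.
Definition matched_cells := layer_match reading_lt scan_start letter_cells.

Lemma mem_tableau_cells s c : ((s, c) \in tableau_cells) = (c < part lam s).
Proof.
rewrite mem_reading_cells -part_gt0 // andb_idl //.
exact: leq_ltn_trans (leq0n _).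
Qed.

Lemma tableau_cells_bounds x :
  x \in tableau_cells -> part lam 0 + x.1 <= k /\ x.2 < part lam 0.
Proof.
case: x => s c; rewrite mem_tableau_cells => cl; split.
  apply: leq_trans muk; rewrite -(tower_last_sumn tA) part0D_leq_sumn //.
  exact: leq_ltn_trans cl.
exact: leq_trans cl (leq_part Plam (leq0n s)).
Qed.

Lemma tableau_cells_window : in_window k (mem tableau_cells).
Proof.
have bounds (x : cell) (xR : x \in tableau_cells) := tableau_cells_bounds xR.
split=> [x /bounds[x1 _] | [s c] [s' c'] /bounds + /bounds].
  exact: leq_trans (leq_addl _ _) x1.
by move: (part lam 0) => width; rewrite /col /=; lia.
Qed.

Lemma tableau_cells_start x : x \in tableau_cells -> reading_lt x scan_start.
Proof.
move/tableau_cells_bounds; rewrite /reading_lt /=.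
by case: x => [[|s] c] //= [? ?]; lia.
Qed.

Lemma tableau_wordE :
  tableau_word (tableau_of A) = map cell_letter tableau_cells.
Proof.
rewrite /tableau_word -map_rev /tableau_cells /reading_cells map_allpairs.
by [].
Qed.

Lemma size_letter_cells a : size (letter_cells a.+1) = nth 0 mu a.
Proof.
rewrite size_filter -(tableau_of_weight tA a) -[LHS](count_map _ (pred1 a.+1)).
by rewrite -tableau_wordE /tableau_word !count_flatten map_rev sumn_rev.
Qed.

Lemma mem_letter_cells x a :
  (x \in letter_cells a) = (cell_letter x == a) && (x \in tableau_cells).
Proof. exact: mem_filter. Qed.

Lemma pairwise_letter_cells a : pairwise reading_lt (letter_cells a).
Proof. exact/pairwise_filter/pairwise_reading_cells. Qed.

Lemma tableau_content_word :
  content_word reading_lt cell_letter scan_start mu tableau_cells.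
Proof.
split; [exact: pairwise_reading_cells | | exact: tableau_cells_start |].
  by move=> [s c]; rewrite mem_tableau_cells => /(entry_bounds tA)/andP[].
exact: size_letter_cells.
Qed.

Lemma leq_cell_letter_add (x y : cell) :
  x.1 <= y.1 -> x.2 <= y.2 -> y \in tableau_cells ->
  cell_letter x + (y.1 - x.1) <= cell_letter y.
Proof.
by case: y => s c; rewrite mem_tableau_cells => *; apply: (leq_entry_add tA).
Qed.

Lemma letter_cells_content a :
  {in letter_cells a &, forall x y, reading_lt x y -> content_lt x y}.
Proof.
move=> x y; rewrite !mem_letter_cells => /andP[/eqP xa xR] /andP[/eqP ya _].
have := @leq_cell_letter_add y x; rewrite xa ya xR => /(_ _ _ isT).
by rewrite /reading_lt /content_lt; lia.
Qed.

Lemma letter_cells_right a (u v : cell) :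
  u \in letter_cells a -> v \in letter_cells a.+1 -> v.1 <= u.1 -> u.2 < v.2.
Proof.
rewrite !mem_letter_cells => /andP[/eqP ua uR] /andP[/eqP va _] vu.
rewrite ltnNge; apply/negP => uv; have := leq_cell_letter_add vu uv uR.
by rewrite ua va; lia.
Qed.

Lemma letter_cells_above a (u v : cell) :
  u \in letter_cells a -> v \in letter_cells a.+1 -> u.1 < v.1 -> u.2 < v.2 ->
  v.1 = u.1.+1 /\ (u.1, v.2) \in letter_cells a.
Proof.
rewrite !mem_letter_cells => /andP[/eqP ua uR] /andP[/eqP va vR] uv1 uv2.
have wR : (u.1, v.2) \in tableau_cells.
  rewrite mem_tableau_cells; apply: leq_trans (leq_part Plam (ltnW uv1)).
  by rewrite -mem_tableau_cells -surjective_pairing.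
have uv := leq_cell_letter_add (ltnW uv1) (ltnW uv2) vR.
have uw := @leq_cell_letter_add u (u.1, v.2) (leqnn _) (ltnW uv2) wR.
have wv := @leq_cell_letter_add (u.1, v.2) v (ltnW uv1) (leqnn _) vR.
rewrite [(u.1, v.2).1]/= in uw wv.
by rewrite wR andbT; split; last apply/eqP; lia.
Qed.

Lemma letter_cells_consecutive a :
  consecutive_layers (letter_cells a) (letter_cells a.+1).
Proof.
move=> u v ua va; split; first exact: letter_cells_right ua va.
by move=> uv1 uv2; case: (letter_cells_above ua va uv1 uv2).
Qed.

Lemma perm_matched_cells a :
  0 < a -> perm_eq (matched_cells a) (letter_cells a).
Proof.
case: a => // a _; apply: perm_greedy_match.
elim: a => [|a IHa] /=; first by rewrite size_nseq.
rewrite size_greedy_match (minn_idPr IHa) !size_letter_cells.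
exact: leq_partS Pmu.
Qed.

Lemma size_matched_cells a : size (matched_cells a.+1) = nth 0 mu a.
Proof. by rewrite (perm_size (perm_matched_cells _)) ?size_letter_cells. Qed.

Lemma mem_matched_cells a x :
  0 < a -> (x \in matched_cells a) = (x \in letter_cells a).
Proof. by move=> a0; rewrite (perm_mem (perm_matched_cells a0)). Qed.

Lemma matched_cells_right_to_left a (u w : cell) :
  0 < a -> u \in letter_cells a -> w \in letter_cells a -> right_of u w ->
  index w (matched_cells a) < index u (matched_cells a).
Proof.
case: a => // a _ ua wa uw; have uM : u \in matched_cells a.+1.
  by rewrite mem_matched_cells.
apply: (greedy_match_right_to_left reading_lt_irr reading_lt_trans) => //.
- exact: pairwise_letter_cells.
- move=> p; case: a ua wa uM => [|a] ua wa uM.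
    rewrite mem_nseq => /andP[_ /eqP->] _; apply: tableau_cells_start.
    by move: wa; rewrite mem_letter_cells => /andP[].
  move=> pM; have pa : p \in letter_cells a.+1 by rewrite -mem_matched_cells.
  have := letter_cells_right pa ua; move: uw; rewrite /right_of /reading_lt.
  by lia.
by move: uw; rewrite /right_of /reading_lt; lia.
Qed.

Lemma matched_cells_exhausted a :
  0 < a -> blocked_exhausted (matched_cells a) (letter_cells a.+1).
Proof.
move=> a0 ps1 u ps2 Ma; have uM : u \in matched_cells a.
  by rewrite Ma mem_cat mem_head orbT.
have ua : u \in letter_cells a by rewrite -mem_matched_cells.
have UM : uniq (matched_cells a).
  rewrite (perm_uniq (perm_matched_cells a0)).
  exact: pairwise_uniq reading_lt_irr (pairwise_letter_cells a).
have index_u : index u (matched_cells a) = size ps1.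
  move: UM; rewrite Ma cat_uniq /= negb_or => /and3P[_ /andP[u_ps1 _] _].
  by rewrite index_cat (negbTE u_ps1) /= eqxx addn0.
rewrite -!size_filter -(size_map (fun v : cell => (u.1, v.2))).
apply: uniq_leq_size.
  rewrite map_inj_in_uniq.
    exact/filter_uniq/(pairwise_uniq reading_lt_irr)/pairwise_letter_cells.
  move=> [s c] [s' c']; rewrite !mem_filter /blocked /=.
  by case/andP=> /andP[/eqP-> _] _ /andP[/andP[/eqP-> _] _] [->].
move=> w /mapP[v]; rewrite mem_filter => /andP[/andP[/eqP v1 v2] va] ->.
have [|_ wa] := letter_cells_above ua va _ v2; first by rewrite v1.
have uw : right_of u (u.1, v.2) by rewrite /right_of eqxx.
rewrite mem_filter uw /=; have := matched_cells_right_to_left a0 ua wa uw.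
by rewrite index_u Ma index_cat; case: ifP => // _; rewrite ltnNge leq_addr.
Qed.

Lemma matched_cells_content a : 0 < a ->
  matched_cells a.+1 =
    greedy_match content_lt (matched_cells a) (letter_cells a.+1) /\
  forall x0 r, r < size (matched_cells a.+1) ->
    reading_lt (nth x0 (matched_cells a) r) (nth x0 (matched_cells a.+1) r) =
    content_lt (nth x0 (matched_cells a) r) (nth x0 (matched_cells a.+1) r).
Proof.
move=> a0; apply: greedy_match_reading_content.
- exact: pairwise_letter_cells.
- move=> u v; rewrite mem_matched_cells //; exact: letter_cells_consecutive.
exact: matched_cells_exhausted.
Qed.

Lemma mem_letter_cells_part a s c : a < size mu ->
  ((s, c) \in letter_cells a.+1) =
  (part (nth [::] A a) s <= c < part (nth [::] A a.+1) s).
Proof.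
move=> am; rewrite mem_letter_cells mem_tableau_cells -(entry_eq tA _ _ am).
rewrite andb_idr // /cell_letter /= (entry_eq tA) // => /andP[_ cl].
apply: leq_trans cl _; rewrite -(tower_part_last tA).
by rewrite (tower_leq_part tA) // am leqnn.
Qed.

Lemma col_letter_cells a s c :
  (s, c) \in letter_cells a -> col k (s, c) + s = k + 2 + c.
Proof.
rewrite mem_letter_cells => /andP[_ /tableau_cells_bounds[]].
by move: (part lam 0) => width; rewrite /col /=; lia.
Qed.

Lemma mem_Vrow_letter_cells a x : 0 < a < size mu ->
  (x \in Vrow k mu A a.+1) = (x \in map (col k) (letter_cells a.+1)).
Proof.
case/andP=> a0 am; have [_ _ PA _ _] := tA; have [_ _ _ _ strips] := abcA.
have mu_pos := all_nthP 0 mu_gt0; have sum_a := tower_sumn tA (ltnW am).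
have row_pos : 0 < sumn (nth [::] A a).
  rewrite sum_a; case: (a) a0 am => // b _ /ltnW bm.
  by rewrite sumn_takeS // ltn_addl // mu_pos.
have row_bound : sumn (nth [::] A a) + nth 0 mu a <= k.
  by rewrite sum_a -sumn_takeS // (leq_trans (sumn_take_leq _ _)).
have VrowP := @mem_Vrow k a.+1 mu A (PA a (ltnW am)) row_pos (mu_pos a am)
  row_bound (strips a.+1 am) x.
apply/idP/mapP => [/VrowP[s [c [sc xE]]] | [[s c] sc xE]]; last apply/VrowP.
  have sc_a : (s, c) \in letter_cells a.+1 by rewrite mem_letter_cells_part.
  by exists (s, c) => //; apply: (@addIn s); rewrite xE (col_letter_cells sc_a).
by exists s, c; rewrite -mem_letter_cells_part // xE (col_letter_cells sc).
Qed.

Lemma tower_first_row : 0 < size mu -> nth [::] A 1 = [:: nth 0 mu 0].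
Proof.
move=> m0; have [_ A0 PA A_sum A_il] := tA.
have /andP[] := A_il 0 m0 0; rewrite A0 part_nil leqn0 => /eqP row1 _.
have := all_nthP 0 mu_gt0 0 m0; have := A_sum 0 m0; rewrite A0 add0n => <-.
have := PA 1 m0; case: (nth [::] A 1) row1 => [|a [|b t]] //=.
  by move=> _ _ _; rewrite addn0.
by rewrite /part /= => ->; rewrite !is_partition_cons !andbF.
Qed.

Lemma letter_cells_first :
  0 < size mu -> letter_cells 1 = [seq (0, c) | c <- iota 0 (nth 0 mu 0)].
Proof.
move=> m0; have [_ A0 _ _ _] := tA.
apply: (irr_sorted_eq reading_lt_trans reading_lt_irr).
- by rewrite (sorted_pairwise reading_lt_trans) pairwise_letter_cells.
- by rewrite (sorted_pairwise reading_lt_trans) pairwise_reading_row.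
move=> [s c]; rewrite mem_letter_cells_part // A0 part_nil tower_first_row //=.
apply/idP/mapP => [|[c' + [-> ->]]]; last by rewrite mem_iota.
by case: s => [|s]; [exists c; rewrite ?mem_iota | rewrite /part /= nth_nil].
Qed.

Lemma matched_cells_first : 0 < size mu ->
  matched_cells 1 = rev [seq (0, c) | c <- iota 0 (nth 0 mu 0)].
Proof.
move=> m0; rewrite -letter_cells_first //.
apply: (greedy_match_nseq (lt := reading_lt)).
  exact: pairwise_uniq reading_lt_irr (pairwise_letter_cells 1).
by move=> x; rewrite mem_letter_cells => /andP[_ /tableau_cells_start].
Qed.

Lemma Erow_first : 0 < size mu ->
  Erow k mu A 1 = [seq [:: col k x] | x <- matched_cells 1].
Proof.
move=> m0; rewrite matched_cells_first // -map_rev -map_comp /mu1 /=.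
apply: (@eq_from_nth _ [::]) => [|r]; rewrite !size_map ?size_rev !size_iota //.
move=> rm; rewrite !(nth_map 0) ?size_rev ?size_iota // nth_rev size_iota //.
rewrite /mu1 in rm *; rewrite !nth_iota //=; last lia.
by congr [:: _]; rewrite /col /=; lia.
Qed.

Lemma Erow_represents i :
  i < size mu -> represents k (Erow k mu A i.+1) (matched_cells i.+1).
Proof.
elim: i => [|i IHi] im; first by rewrite Erow_first //; apply: represents_map.
rewrite (matched_cells_content (ltn0Sn i)).1.
apply: (build_row_represents tableau_cells_window).
- by move=> x; rewrite mem_matched_cells // mem_letter_cells => /andP[].
- by move=> x; rewrite mem_letter_cells => /andP[].
- exact: pairwise_letter_cells.
- exact: letter_cells_content.
- by move=> x; rewrite andbT mem_Vrow_letter_cells.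
exact/IHi/ltnW.
Qed.

Definition matched_round r := round scan_start matched_cells (conj_part mu r) r.

Lemma ltn_size_matched_cells i r :
  i < size mu -> (r < size (matched_cells i.+1)) = (i < conj_part mu r).
Proof. by move=> im; rewrite size_matched_cells ltn_conj_part. Qed.

Lemma Erow_entry i r : i < size mu ->
  nth [::] (Erow k mu A i.+1) r =i
  if i < conj_part mu r then [:: col k (nth scan_start (matched_cells i.+1) r)]
  else [::].
Proof.
move=> im x; rewrite (Erow_represents im) -ltn_size_matched_cells //.
case: ltnP => [rM | Mr]; last by rewrite drop_oversize.
by rewrite (drop_nth scan_start rM) /= take0.
Qed.

Lemma Ecols_round r :
  Ecols k mu A r.+1 = map (col k) (matched_round r).
Proof.
rewrite /Ecols /= (@find_iota1 _ (size mu) (conj_part mu r)); first last.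
- move=> i im; have := Erow_entry r im.
  have [_ entryE | ri entryE] := ltnP i; last first.
    by rewrite (eq_mem_nil entryE) eqxx.
  by apply/negbTE; have [] := eq_mem_seq1 0 entryE.
- exact: conj_part_leq_size.
rewrite take_iota (minn_idPl (conj_part_leq_size _ _)) -map_comp.
apply/eq_in_map => -[|i]; rewrite mem_iota // add1n !ltnS => /= ir.
have := Erow_entry r (leq_trans ir (conj_part_leq_size _ _)).
by rewrite ir => entryE; have [] := eq_mem_seq1 0 entryE.
Qed.

Lemma round_charge r :
  rel_charge 0 ltn (map (col k) (matched_round r)) =
  rel_charge scan_start reading_lt (matched_round r).
Proof.
have size_round : size (matched_round r) = conj_part mu r.
  by rewrite size_map size_iota.
have nth_round i : i < conj_part mu r ->
    nth scan_start (matched_round r) i = nth scan_start (matched_cells i.+1) r.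
  by move=> ir; rewrite (nth_map 0) ?size_iota // nth_iota.
have in_round i : i < conj_part mu r ->
    nth scan_start (matched_cells i.+1) r \in tableau_cells.
  move=> ir; have im := leq_trans ir (conj_part_leq_size _ _).
  have : nth scan_start (matched_cells i.+1) r \in letter_cells i.+1.
    by rewrite -mem_matched_cells // mem_nth // ltn_size_matched_cells.
  by rewrite mem_letter_cells => /andP[].
apply: eq_rel_charge => [|t]; rewrite size_map size_round // => tr.
have tr' := ltnW tr; have im := leq_trans tr (conj_part_leq_size _ _).
rewrite !(nth_map scan_start) ?size_round // !nth_round //=.
rewrite (matched_cells_content (ltn0Sn t)).2 ?ltn_size_matched_cells //.
by rewrite (content_lt_window tableau_cells_window) ?in_round.
Qed.

Lemma ABC_charge_tableau :
  ABC_charge k mu A = tableau_charge (tableau_of A).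
Proof.
rewrite /tableau_charge /word_charge tableau_wordE size_map.
rewrite (word_charge_rounds reading_lt_irr reading_lt_trans Pmu
  tableau_content_word) //.
rewrite /ABC_charge sumn_map_iota /mu1; apply: eq_bigr => r _.
by rewrite add1n Ecols_round perm_charge_reading round_charge.
Qed.
End Charge.

Theorem mainTheorem1 (n : nat) (lam mu : seq nat) :
  0 < n -> partition_of n lam -> partition_of n mu ->
  exists f : seq (seq nat) -> seq (seq nat),
    [/\ (forall A, ABC_set n lam mu A -> is_SSYT lam mu (f A)),
        (forall A B, ABC_set n lam mu A -> ABC_set n lam mu B -> f A = f B -> A = B),
        (forall T, is_SSYT lam mu T -> exists2 A, ABC_set n lam mu A & f A = T) &
        (forall A, ABC_set n lam mu A -> ABC_charge n mu A = tableau_charge (f A))].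
Proof.
move=> _ /andP[Plam _] mu_n; have abcP A := ABC_set_tower lam A mu_n.
exists tableau_of; split.
- by move=> A /abcP[tA <-]; apply: tableau_of_SSYT.
- move=> A B /abcP[tA lastA] /abcP[tB lastB].
  by apply: (tableau_of_inj tA tB); rewrite lastA lastB.
- move=> T ssytT; exists (tower_of mu T); last exact: tableau_of_tower_of ssytT.
  apply/abcP; split; first exact: tower_of_tower ssytT.
  exact: last_tower_of ssytT.
case/andP: mu_n => Pmu /eqP mu_n A [abcA _ _].
by apply: ABC_charge_tableau; rewrite ?mu_n.
Qed.
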